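(* Let $\alpha,\beta,\eta\in(0,1)$ be such that $\alpha+\beta+\eta<1$, and let $\delta>0$, $R>0$ and $R'\ge1$. Then there exists a positive constant $C(p,q,\alpha,\beta,\delta,R,R',\eta)$, depending only on its arguments, such that, for $n$ large enough, $$\rho(\mathcal{S}^\delta_{p+q}(R,R'),\alpha,\beta)\ge C(p,q,\alpha,\beta,\delta,R,R',\eta)\,n^{-2\delta/(4\delta+p+q)}.$$
   Context: $p,q\ge1$ are fixed integers. $f$ denotes a probability density with respect to Lebesgue measure on $\mathbb{R}^p\times\mathbb{R}^q$ with marginal densities $f_1$ on $\mathbb{R}^p$ and $f_2$ on $\mathbb{R}^q$; $(f_1\otimes f_2)(x,y)=f_1(x)f_2(y)$; $P_f$ is the law of an i.i.d. $n$-sample $\mathbb{Z}_n=(X_i,Y_i)_{1\le i\le n}$ with density $f$. An $\alpha$-level test (of the null hypothesis $f=f_1\otimes f_2$ against $f\ne f_1\otimes f_2$) is a measurable function $\Delta_\alpha$ of the sample with values in $\{0,1\}$ such that $P_{f_1\otimes f_2}(\Delta_\alpha=1)\le\alpha$ for all densities $f_1$ on $\mathbb{R}^p$ and $f_2$ on $\mathbb{R}^q$. $\mathcal{S}^\delta_d(R)$ is the set of real-valued $s\in\mathbb{L}_1(\mathbb{R}^d)\cap\mathbb{L}_2(\mathbb{R}^d)$ with $\int_{\mathbb{R}^d}\|u\|^{2\delta}|\hat s(u)|^2du\le(2\pi)^dR^2$, where $\|\cdot\|$ is the Euclidean norm and $\hat s(u)=\int s(x)e^{i\langle x,u\rangle}dx$.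 For $\rho>0$ let $\mathcal{F}_\rho$ be the set of densities $f$ with $f-f_1\otimes f_2\in\mathcal{S}^\delta_{p+q}(R)$, $\max\{\|f\|_\infty,\|f_1\|_\infty,\|f_2\|_\infty\}\le R'$ and $\|f-f_1\otimes f_2\|_2>\rho$. The uniform separation rate of $\Delta_\alpha$ is $\rho(\Delta_\alpha,\mathcal{S}^\delta_{p+q}(R,R'),\beta)=\inf\{\rho>0:\sup_{f\in\mathcal{F}_\rho}P_f(\Delta_\alpha=0)\le\beta\}$, and the non-asymptotic minimax rate of testing is $$\rho(\mathcal{S}^\delta_{p+q}(R,R'),\alpha,\beta)=\inf_{\Delta_\alpha}\rho(\Delta_\alpha,\mathcal{S}^\delta_{p+q}(R,R'),\beta),$$ the infimum being over all $\alpha$-level tests. *)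

(* Defs.v *)
From HB Require Import structures.
From mathcomp Require Import all_boot all_order all_algebra.
From mathcomp Require Import all_classical all_reals all_analysis.
From mathcomp Require Import measurable_realfun.
From mathcomp Require Import complex.

Set Implicit Arguments.
Unset Strict Implicit.
Unset Printing Implicit Defensive.

Import Order.TTheory GRing.Theory Num.Theory.
Import numFieldNormedType.Exports.

Local Open Scope classical_set_scope.
Local Open Scope ring_scope.

Section product_cons.
Context d (T : measurableType d) (R : realType) (n : nat).
Local Open Scope ereal_scope.

Definition cons_pair (z : T * n.-tuple T) : n.+1.-tuple T :=
  [the n.+1.-tuple T of z.1 :: z.2].

Lemma measurable_cons_pair : measurable_fun [set: T * n.-tuple T] cons_pair.
Proof.
have := @measurable_cons _ _ (T * n.-tuple T)%type T fst n snd.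
by apply; [exact: measurable_fst|exact: measurable_snd].
Qed.

Variables (m1 : {sigma_finite_measure set T -> \bar R})
  (m2 : {sigma_finite_measure set (n.-tuple T) -> \bar R}).

Definition product_cons : set (n.+1.-tuple T) -> \bar R :=
  pushforward (m1 \x m2) cons_pair.

Let mpre A : measurable A -> measurable (cons_pair @^-1` A).
Proof.
by move=> mA; rewrite -[X in measurable X]setTI; exact: measurable_cons_pair.
Qed.

Let product_cons0 : product_cons set0 = 0.
Proof. by rewrite /product_cons /pushforward preimage_set0 measure0. Qed.

Let product_cons_ge0 A : 0 <= product_cons A.
Proof. by rewrite /product_cons /pushforward measure_ge0. Qed.

Let product_cons_sigma_additive : semi_sigma_additive product_cons.
Proof.
move=> F mF tF mUF; rewrite /product_cons /pushforward preimage_bigcup.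
apply: measure_semi_sigma_additive.
- by move=> k; exact: mpre.
- apply/trivIsetP => /= i j _ _ ij; rewrite -preimage_setI.
  by move/trivIsetP : tF => /(_ _ _ _ _ ij) ->//; rewrite preimage_set0.
- by rewrite -preimage_bigcup; exact: mpre.
Qed.

HB.instance Definition _ := isMeasure.Build _ _ _ product_cons
  product_cons0 product_cons_ge0 product_cons_sigma_additive.

Let product_cons_sigma_finite : sigma_finite setT product_cons.
Proof.
have /sigma_finiteP[F [TF ndF Foo]] := sigma_finiteT m1.
have /sigma_finiteP[G [TG ndG Goo]] := sigma_finiteT m2.
pose g (t : n.+1.-tuple T) : T * n.-tuple T := (thead t, [tuple of behead t]).
have gK z : g (cons_pair z) = z.
  case: z => x t; rewrite /g /cons_pair; congr (_, _).
  exact: val_inj.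
have cK t : cons_pair (g t) = t by rewrite [RHS]tuple_eta; exact: val_inj.
have mg : measurable_fun setT g.
  apply/measurable_fun_pairP; split.
    exact: measurable_tnth.
  exact: measurable_behead.
exists (fun k => g @^-1` (F k `*` G k)).
  rewrite -preimage_bigcup; apply/esym/seteqP; split => // t _ /=.
  have [i _ Fi] : (\bigcup_i F i) (g t).1 by rewrite -TF.
  have [j _ Gj] : (\bigcup_j G j) (g t).2 by rewrite -TG.
  exists (maxn i j) => //; split.
    by move: Fi; exact/subsetPset/ndF/leq_maxl.
  by move: Gj; exact/subsetPset/ndG/leq_maxr.
move=> k; have [mFk Fk] := Foo k; have [mGk Gk] := Goo k; split.
  rewrite -[X in measurable X]setTI; apply: mg => //; exact: measurableX.
rewrite /product_cons /pushforward -comp_preimage.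
rewrite (_ : g \o cons_pair = id); last by apply/funext => z; exact: gK.
by rewrite preimage_id product_measure1E// lte_mul_pinfty// ge0_fin_numE.
Qed.

HB.instance Definition _ := Measure_isSigmaFinite.Build _ _ _ product_cons
  product_cons_sigma_finite.

End product_cons.

Section iterated_product.
Context d (T : measurableType d) (R : realType).
Local Open Scope ereal_scope.

Fixpoint iter_product (m : {sigma_finite_measure set T -> \bar R}) (n : nat) :
    {sigma_finite_measure set (n.-tuple T) -> \bar R} :=
  match n with
  | 0 => dirac [tuple]
  | k.+1 => product_cons m (iter_product m k)
  end.

Lemma iter_product_rect (m : {sigma_finite_measure set T -> \bar R}) (n : nat)
    (A : 'I_n -> set T) : (forall i, measurable (A i)) ->
  iter_product m n [set t | forall i, A i (tnth t i)] = \prod_(i < n) m (A i).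
Proof.
elim: n A => [|n IH] A mA.
  by rewrite big_ord0 /= diracE mem_set// => -[].
have mB : measurable [set t : n.-tuple T | forall i, A (lift ord0 i) (tnth t i)].
  rewrite (_ : [set _ | _] = \bigcap_(i in setT)
      ((fun t : n.-tuple T => tnth t i) @^-1` A (lift ord0 i))); last first.
    by apply/seteqP; split => [t h i _|t h i]; [exact: h|exact: (h i)].
  apply: fin_bigcap_measurable => // i _.
  by rewrite -[X in measurable X]setTI; exact: measurable_tnth.
rewrite big_ord_recl -IH// -product_measure1E//=.
rewrite /product_cons /pushforward; congr (_ _).
apply/seteqP; split => -[x t] /=.
  move=> h; split; first by have := h ord0.
  by move=> i; have := h (lift ord0 i); rewrite tnthS.
move=> [hx ht] i; case: (unliftP ord0 i) => [j ->|->//].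
by rewrite tnthS; exact: ht.
Qed.

End iterated_product.

Section density.
Context d (T : measurableType d) (R : realType).
Local Open Scope ereal_scope.

Record density (mu : {measure set T -> \bar R}) := Density {
  density_fun :> T -> R;
  measurable_density : measurable_fun [set: T] density_fun;
  density_ge0 : forall x, (0 <= density_fun x)%R;
  integral_density : \int[mu]_x (density_fun x)%:E = 1 }.

Variables (mu : {measure set T -> \bar R}) (f : density mu).

Definition density_prob : set T -> \bar R :=
  fun A => \int[mu]_(x in A) (f x)%:E.

Let density_prob0 : density_prob set0 = 0.
Proof. by rewrite /density_prob integral_set0. Qed.

Let density_prob_ge0 A : 0 <= density_prob A.
Proof. by apply: integral_ge0 => x _; rewrite lee_fin density_ge0. Qed.

Let density_prob_sigma_additive : semi_sigma_additive density_prob.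
Proof.
move=> /= F mF tF mUF; rewrite /density_prob; apply: cvg_toP.
  apply: ereal_nondecreasing_is_cvgn => m n mn.
  apply: lee_sum_nneg_natr => // k _ _; exact: density_prob_ge0.
rewrite ge0_integral_bigcup//=.
- apply: measurable_funTS; apply/measurable_EFinP; exact: measurable_density.
- by move=> x _; rewrite lee_fin density_ge0.
Qed.

HB.instance Definition _ := isMeasure.Build _ _ _ density_prob
  density_prob0 density_prob_ge0 density_prob_sigma_additive.

Let density_prob_setT : density_prob [set: T] = 1.
Proof. exact: integral_density. Qed.

HB.instance Definition _ :=
  @Measure_isProbability.Build _ _ R density_prob density_prob_setT.

End density.

Section tensor.
Context d1 d2 (T1 : measurableType d1) (T2 : measurableType d2) (R : realType).
Variables (m1 : {sigma_finite_measure set T1 -> \bar R})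
  (m2 : {sigma_finite_measure set T2 -> \bar R}).

Definition tensor (f1 : T1 -> R) (f2 : T2 -> R) (z : T1 * T2) : R :=
  f1 z.1 * f2 z.2.

Variables (f1 : density m1) (f2 : density m2).

Lemma measurable_tensor : measurable_fun [set: T1 * T2] (tensor f1 f2).
Proof.
apply: measurable_funM.
  exact: (measurableT_comp (measurable_density f1) measurable_fst).
exact: (measurableT_comp (measurable_density f2) measurable_snd).
Qed.

Lemma tensor_ge0 z : 0 <= tensor f1 f2 z.
Proof. by rewrite mulr_ge0 ?density_ge0. Qed.

Lemma integral_tensor :
  (\int[m1 \x m2]_z (tensor f1 f2 z)%:E = 1)%E.
Proof.
rewrite fubini_tonelli1//=; first last.
- by move=> z; rewrite lee_fin tensor_ge0.
- by apply/measurable_EFinP; exact: measurable_tensor.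
rewrite /fubini_F /tensor /=.
under eq_integral => x _.
  under eq_integral do rewrite EFinM.
  rewrite ge0_integralZl//=; first last.
  - by rewrite lee_fin density_ge0.
  - by move=> y _; rewrite lee_fin density_ge0.
  - by apply/measurable_EFinP; exact: measurable_density.
  rewrite integral_density mule1.
  over.
exact: integral_density.
Qed.

Definition tensor_density : density (m1 \x m2)%E :=
  Density measurable_tensor tensor_ge0 integral_tensor.

End tensor.

(* The Lebesgue measure of the library lives on measurableTypeR R, a copy of R
   endowed with its Borel sigma-algebra. *)
Notation euclid R d := (d.-tuple (measurableTypeR R)).
Notation sample R p q n := (n.-tuple (euclid R p * euclid R q)%type).

Section euclidean_space.
Variable R : realType.

Definition lebesgue (d : nat) : {sigma_finite_measure set (euclid R d) -> \bar R} :=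
  iter_product (@lebesgue_measure R) d.

Definition dotp (d : nat) (x u : euclid R d) : R :=
  \sum_(i < d) (tnth x i : R) * (tnth u i : R).

Definition enorm (d : nat) (u : euclid R d) : R := Num.sqrt (dotp u u).

(* Integral of s(x) e^{i<x,u>}, with real and imaginary parts integrated
   separately. *)
Definition fourier (d : nat) (s : euclid R d -> R) (u : euclid R d) : R[i] :=
  ((\int[lebesgue d]_x (s x * cos (dotp x u)))%R +i*
   (\int[lebesgue d]_x (s x * sin (dotp x u)))%R)%C.

Definition sobolev_ball (d : nat) (delta r : R) : set (euclid R d -> R) :=
  [set s | [/\ s \in Lfun (lebesgue d) 1%E,
               s \in Lfun (lebesgue d) 2%:E &
     (\int[lebesgue d]_u
        (enorm u `^ (2 * delta) * Normc.normc (fourier s u) ^+ 2)%:E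
      <= ((2 * pi) ^+ d * r ^+ 2)%:E)%E]].

Definition split_tuple (p q : nat) (z : euclid R (p + q)) :
    euclid R p * euclid R q :=
  ([tuple tnth z (lshift q i) | i < p], [tuple tnth z (rshift p j) | j < q]).

End euclidean_space.

Section independence_testing.
Variables (R : realType) (p q : nat).

Definition lebesgue2 : {measure set (euclid R p * euclid R q)%type -> \bar R} :=
  (lebesgue R p \x lebesgue R q)%E.

(* The value is 0 on the null set where the integral diverges. *)
Definition marginal1 (f : density lebesgue2) (x : euclid R p) : R :=
  (\int[lebesgue R q]_y f (x, y))%R.

Definition marginal2 (f : density lebesgue2) (y : euclid R q) : R :=
  (\int[lebesgue R p]_x f (x, y))%R.

Definition dependence (f : density lebesgue2) (z : euclid R p * euclid R q) : R :=
  f z - tensor (marginal1 f) (marginal2 f) z.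

Definition iid_law (n : nat) (f : density lebesgue2) :
    {sigma_finite_measure set (sample R p q n) -> \bar R} :=
  iter_product (density_prob f) n.

Definition level_test (n : nat) (alpha : R) :
    set (sample R p q n -> bool) :=
  [set Delta | measurable_fun setT Delta /\
    forall (f1 : density (lebesgue R p)) (f2 : density (lebesgue R q)),
      (iid_law n (tensor_density f1 f2) [set z | Delta z = true]
        <= alpha%:E)%E].

Definition alternatives (delta r r' rho : R) : set (density lebesgue2) :=
  [set f | [/\ sobolev_ball delta r (dependence f \o @split_tuple R p q),
     (maxe ('N[lebesgue2]_+oo[EFin \o f])
       (maxe ('N[lebesgue R p]_+oo[EFin \o marginal1 f])
             ('N[lebesgue R q]_+oo[EFin \o marginal2 f])) <= r'%:E)%E &
     (rho%:E < 'N[lebesgue2]_2%:E[EFin \o dependence f])%E]].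

(* When there is no alternative left the supremum is -oo, so that the
   constraint on rho holds. *)
Definition separation_rate (n : nat) (delta r r' beta : R)
    (Delta : sample R p q n -> bool) : \bar R :=
  ereal_inf [set rho%:E | rho in [set rho : R | 0 < rho /\
    (ereal_sup [set iid_law n f [set z | Delta z = false]
               | f in alternatives delta r r' rho] <= beta%:E)%E]].

Definition minimax_rate (n : nat) (delta r r' alpha beta : R) : \bar R :=
  ereal_inf [set separation_rate delta r r' beta Delta
            | Delta in @level_test n alpha].

End independence_testing.

(* Main.v *)
Require Import Defs.
From HB Require Import structures.
From mathcomp Require Import all_boot all_order all_algebra.
From mathcomp Require Import all_classical all_reals all_analysis.
From mathcomp Require Import complex measurable_realfun ess_sup_inf ring lra.

Set Implicit Arguments.
Unset Strict Implicit.
Unset Printing Implicit Defensive.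

Import Order.TTheory GRing.Theory Num.Theory.
Import numFieldNormedType.Exports.

Local Open Scope classical_set_scope.
Local Open Scope ring_scope.

(** The proof hides many small bumps of random sign in a product density and
    shows that no level test can tell the result from the product.

    Write d = p + q. The unperturbed density is uniform on the cube [0,
    2]^d, which is a product density. Its subcube [0, 1]^d is divided into
    M^d cells, and on each cell one adds gam times a product of d smooth
    one-dimensional bumps, with a sign th. Each bump has integral zero, so
    the marginals do not change ([marginal1_perturbed],
    [marginal2_perturbed]) and the added noise is exactly f - f1 (x) f2
    ([dependence_perturbed]). As the cells are disjoint, the squared L2 norm
    of the noise is of order gam^2 ([noise_sqr_ge]).

    Smoothness. The bumps are polynomials that vanish to a high order at the
    ends of their cells; integrating by parts repeatedly, their Fourier
    transform decays as fast as wanted ([wave_integral_fast_decay]), and the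
    transform of a product is a product ([cos_transform_sqr]). For a fixed
    sign pattern the transforms of the M^d cells interfere, but on average
    over the signs the cross terms disappear ([sum_sgn_sqr]). So the average
    of the Sobolev integral is of order (gam M^delta)^2 ([sum_energy]), and
    by Markov's inequality all but a proportion eta of the sign patterns
    give an alternative as soon as gam = c / M^delta with c small.

    Indistinguishability. Let L be the average over th of the likelihood
    ratios of the n-sample. The second moment of L under the product law is
    an average over pairs (th, th') of (1 + sum of b th th')^n, where the
    sum runs over the cells and b is at most of order gam^2 / M^d
    ([likelihood_mul_integral]). Averaging the exponential over the signs
    gives at most exp (C n^2 gam^4 / M^d) ([sum_likelihood_mul]). The
    probability of rejection under the mixture thus exceeds alpha by little
    ([second_moment_bound]). But a test of type II error at most beta on all
    the alternatives has, on average, a power of at least 1 - beta - eta. As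
    alpha + beta + eta < 1, this is a contradiction when n^2 gam^4 / M^d is
    small ([separation_lower_bound]).

    With gam = c / M^delta the last condition reads n^2 <= M^(4 delta + d),
    so that M is taken as n^(2 / (4 delta + d)), rounded up. The separation
    is of order gam, that is n^(- 2 delta / (4 delta + d)). *)

(** * Integration over product spaces *)

Section change_of_density.
Context d (T : measurableType d) (R : realType).
Variables (mu : {measure set T -> \bar R}) (f : density mu).
Local Open Scope ereal_scope.
Import HBNNSimple.

(** Both sides are continuous along the increasing approximation of [G] by
    simple functions and agree, by definition, on indicators. *)
Lemma ge0_integral_density_prob (G : T -> \bar R) :
  measurable_fun setT G -> (forall x, 0 <= G x) ->
  \int[density_prob f]_x G x = \int[mu]_x (G x * (f x)%:E).
Proof.
move=> mG G0; pose h := nnsfun_approx measurableT mG.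
have mf : measurable_fun setT (EFin \o f).
  exact/measurable_EFinP/measurable_density.
have f0 x : 0 <= (f x)%:E by rewrite lee_fin density_ge0.
have mh n : measurable_fun setT (EFin \o h n) by exact/measurable_EFinP.
have hG x : (EFin \o h n) x @[n --> \oo] --> G x.
  exact: cvg_nnsfun_approx.
have ndh x : {homo (fun n => (EFin \o h n) x) : a b / (a <= b)%N >-> a <= b}.
  by move=> a b ab; rewrite lee_fin; exact/lefP/nd_nnsfun_approx.
transitivity (limn (fun n => \int[density_prob f]_x (EFin \o h n) x)).
  rewrite -monotone_convergence//.
  - by apply: eq_integral => x _; apply/esym/cvg_lim => //; exact: hG.
  - by move=> n x _; rewrite lee_fin.
transitivity (limn (fun n => \int[mu]_x ((EFin \o h n) x * (f x)%:E)));
    last first.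
  rewrite -monotone_convergence//.
  - apply: eq_integral => x _; apply/cvg_lim => //.
    have := cvgeZr (isT : (f x)%:E \is a fin_num) (hG x); exact.

  - by move=> n; apply: emeasurable_funM.
  - by move=> n x _; rewrite mule_ge0// lee_fin.
  - by move=> x _ a b ab; rewrite lee_wpmul2r//; exact: ndh.
congr (limn _); apply/funext => n.
transitivity (\int[density_prob f]_x
    (\sum_(y \in range (h n)) (y * \1_(h n @^-1` [set y]) x)%:E)).
  by apply: eq_integral => t _; rewrite /= fimfunE -fsumEFin.
have mind r : measurable_fun setT (fun x => (r * \1_(h n @^-1` [set r]) x)%:E).
  by apply/measurable_EFinP; apply: measurable_funM.
rewrite ge0_integral_fsum//; last by move=> m y Ey; exact: nnfun_muleindic_ge0.
transitivity (\int[mu]_x (\sum_(y \in range (h n))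
    (y * \1_(h n @^-1` [set y]) x)%:E * (f x)%:E)); last first.
  apply: eq_integral => x _.
  rewrite -ge0_mule_fsuml => [|y]; last exact: nnfun_muleindic_ge0.
  by rewrite fsumEFin // -(fimfunE _ x).
rewrite ge0_integral_fsum//; last 2 first.
  - by move=> y; apply: emeasurable_funM.
  - by move=> m y _; rewrite mule_ge0// nnfun_muleindic_ge0.
apply: eq_fsbigr => r rhn; rewrite integralZl_indic_nnsfun//.
under [RHS]eq_integral do rewrite EFinM -muleA.
rewrite ge0_integralZl//; last 3 first.
- by apply: emeasurable_funM => //; exact/measurable_EFinP.
- by move=> x _; rewrite mule_ge0// lee_fin.
- by move: rhn; rewrite inE => -[x _ <-]; rewrite lee_fin.
rewrite integral_indic// setIT; congr (_ * _).
transitivity (\int[mu]_(x in h n @^-1` [set r]) (f x)%:E) => //.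
rewrite integral_mkcond; apply: eq_integral => x _; rewrite patchE indicE.
by case: ifPn; rewrite ?mul1e ?mul0e.
Qed.

End change_of_density.

Section product_cons_integral.
Context d (T : measurableType d) (R : realType) (n : nat).
Variables (m1 : {sigma_finite_measure set T -> \bar R})
  (m2 : {sigma_finite_measure set (n.-tuple T) -> \bar R}).
Local Open Scope ereal_scope.

Lemma ge0_integral_product_cons (F : n.+1.-tuple T -> \bar R) :
  measurable_fun setT F -> (forall t, 0 <= F t) ->
  \int[product_cons m1 m2]_t F t =
  \int[m1]_x \int[m2]_t F (cons_pair (x, t)).
Proof.
move=> mF F0; have mc := @measurable_cons_pair _ T n.
transitivity (\int[pushforward (m1 \x m2) (@cons_pair _ T n)]_t F t).
  by apply: eq_measure_integral.
rewrite (ge0_integral_pushforward mc)// preimage_setT.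
rewrite (fubini_tonelli1 (F \o @cons_pair _ T n))//.
  exact: measurableT_comp.
by move=> z; exact: F0.
Qed.

Lemma integrable_product_cons (F : n.+1.-tuple T -> R) :
  measurable_fun setT F ->
  (m1 \x m2).-integrable setT (fun z => (F (cons_pair z))%:E) ->
  (product_cons m1 m2).-integrable setT (EFin \o F) /\
  (\int[product_cons m1 m2]_t F t = \int[m1 \x m2]_z F (cons_pair z))%R.
Proof.
move=> mF iF; have mc := @measurable_cons_pair _ T n.
split.
  have /integrableP[m i] := @integrable_pushforward _ _ _ _ _ _ mc (m1 \x m2)
    setT (EFin \o F) ((measurable_EFinP _ _).2 mF) iF measurableT.
  exact/integrableP.
congr fine.
rewrite -[RHS](@integral_pushforward _ _ _ _ _ _ mc (m1 \x m2) setT (EFin \o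
  F)) //.
  exact/measurable_EFinP.
Qed.

End product_cons_integral.

Section tensor_integral.
Context d1 d2 (T1 : measurableType d1) (T2 : measurableType d2) (R : realType).
Variables (m1 : {sigma_finite_measure set T1 -> \bar R})
  (m2 : {sigma_finite_measure set T2 -> \bar R}).

(** Integrability and the product formula go together: they are what turns a
    d-dimensional Fourier integral of a product into one-dimensional ones. *)
Lemma integrable_tensor (g : T1 -> R) (h : T2 -> R) :
  m1.-integrable setT (EFin \o g) -> m2.-integrable setT (EFin \o h) ->
  (m1 \x m2)%E.-integrable setT (EFin \o tensor g h).
Proof.
move=> ig ih; have mg := measurable_int _ ig; have mh := measurable_int _ ih.
have mgh : measurable_fun setT (tensor g h).
  apply: measurable_funM.
    by apply: measurableT_comp; [exact/measurable_EFinP|exact: measurable_fst].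
  by apply: measurableT_comp; [exact/measurable_EFinP|exact: measurable_snd].
apply/integrable12ltyP; first exact/measurable_EFinP.
have iah : m2.-integrable setT (fun y => `|h y|%:E) by exact: integrable_norm.
have mah : measurable_fun setT (fun y => `|h y|%:E) by exact: measurable_int
  iah.
rewrite (_ : (\int[m1]_x _)%E =
    (\int[m1]_x (`|g x|%:E * \int[m2]_y `|h y|%:E))%E); last first.
  apply: eq_integral => x _; rewrite -ge0_integralZl//.
  by apply: eq_integral => y _; rewrite /tensor /= normrM EFinM.
rewrite ge0_integralZr//; last first.
- by apply: integral_ge0 => y _; rewrite lee_fin.
- by apply: measurable_int (_ : m1.-integrable _ _); exact: integrable_norm.
apply: lte_mul_pinfty.
- by apply: integral_ge0 => y _; rewrite lee_fin.
- by apply: integrable_fin_num => //; exact: integrable_norm.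
- by rewrite -ge0_fin_numE; [exact: integrable_fin_num|exact: integral_ge0].
Qed.

Lemma Rintegral_tensor (g : T1 -> R) (h : T2 -> R) :
  m1.-integrable setT (EFin \o g) -> m2.-integrable setT (EFin \o h) ->
  \int[(m1 \x m2)%E]_z tensor g h z = \int[m1]_x g x * \int[m2]_y h y.
Proof.
move=> ig ih; rewrite {1}/Rintegral -integral12_prod_meas1//; last first.
  exact: integrable_tensor.
rewrite (_ : (\int[m1]_x _)%E = (\int[m1]_x ((g x)%:E * \int[m2]_y (h
  y)%:E))%E).
  rewrite -(fineK (integrable_fin_num measurableT ih)) integralZr//.
  by rewrite fineM//; exact: integrable_fin_num.
apply: eq_integral => x _; rewrite -integralZl//.
Qed.

End tensor_integral.

Section iter_product_integral.
Context d (T : measurableType d) (R : realType).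

Lemma measurable_prod_tnth (n : nat) (G : 'I_n -> T -> R) :
  (forall i, measurable_fun setT (G i)) ->
  measurable_fun setT (fun t : n.-tuple T => \prod_(i < n) G i (tnth t i)).
Proof.
move=> mG; apply: measurable_prod => i _.
by apply: measurableT_comp => //; exact: measurable_tnth.
Qed.

Lemma prod_cons_pair (n : nat) (G : 'I_n.+1 -> T -> R) (z : T * n.-tuple T) :
  \prod_(i < n.+1) G i (tnth (cons_pair z) i) =
  tensor (G ord0) (fun t : n.-tuple T =>
    \prod_(i < n) G (lift ord0 i) (tnth t i)) z.
Proof.
by rewrite big_ord_recl /tensor; congr (_ * _); apply: eq_bigr => i _; rewrite
  tnthS.
Qed.

Lemma ge0_integral_iter_product_prod (m : {sigma_finite_measure set T -> \bar
  R})
    (n : nat) (G : 'I_n -> T -> R) :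
  (forall i, measurable_fun setT (G i)) -> (forall i x, 0 <= G i x) ->
  (\int[iter_product m n]_t (\prod_(i < n) G i (tnth t i))%:E =
   \prod_(i < n) \int[m]_x (G i x)%:E)%E.
Proof.
elim: n G => [|n IH] G mG G0.
  rewrite big_ord0 /= integral_dirac//.
    by rewrite diracT mul1e big_ord0.
  by apply/measurable_EFinP; exact: measurable_prod_tnth.
rewrite [LHS]ge0_integral_product_cons; last 2 first.
- by apply/measurable_EFinP; exact: measurable_prod_tnth.
- by move=> t; rewrite lee_fin prodr_ge0.
rewrite big_ord_recl -IH//.
have m0 : measurable_fun setT (fun t : n.-tuple T =>
    (\prod_(i < n) G (lift ord0 i) (tnth t i))%:E).
  apply/measurable_EFinP.
  exact: (measurable_prod_tnth (G := fun i => G (lift ord0 i))).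
rewrite -ge0_integralZr//; first last.
- by apply: integral_ge0 => t _; rewrite lee_fin prodr_ge0.
- by move=> x _; rewrite lee_fin.
- exact/measurable_EFinP.
apply: eq_integral => x _.
under eq_integral do rewrite prod_cons_pair /tensor EFinM /=.
by rewrite ge0_integralZl// => [t _|]; rewrite lee_fin// prodr_ge0.
Qed.

Lemma integrable_iter_product_prod (m : {sigma_finite_measure set T -> \bar R})
    (n : nat) (G : 'I_n -> T -> R) :
  (forall i, m.-integrable setT (EFin \o G i)) ->
  (iter_product m n).-integrable setT
    (fun t => (\prod_(i < n) G i (tnth t i))%:E) /\
  (\int[iter_product m n]_t \prod_(i < n) G i (tnth t i) =
   \prod_(i < n) \int[m]_x G i x).
Proof.
elim: n G => [|n IH] G iG.
  have m0 : measurable_fun setT (fun t : 0.-tuple T =>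
      (\prod_(i < 0) G i (tnth t i))%:E).
    by apply/measurable_EFinP; apply: (@measurable_prod_tnth 0%N G) => -[].
  split; last by rewrite /Rintegral /= integral_dirac// diracT mul1e !big_ord0.
  apply/integrableP; split; first exact: m0.
  rewrite /= integral_dirac//; last first.
    apply/measurable_EFinP; apply: measurableT_comp => //.
    exact/measurable_EFinP.
  by rewrite diracT mul1e ltry.
have [i1 e1] := IH (fun i => G (lift ord0 i)) (fun i => iG _).
have mF : measurable_fun setT (fun t : n.+1.-tuple T =>
    \prod_(i < n.+1) G i (tnth t i)).
  apply: measurable_prod_tnth => i.
  by apply/measurable_EFinP; exact: (measurable_int _ (iG i)).
have iF : (m \x iter_product m n)%E.-integrable setT
    (fun z => (\prod_(i < n.+1) G i (tnth (cons_pair z) i))%:E).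
  have := integrable_tensor (iG ord0) i1.
  by apply: eq_integrable => // z _; rewrite prod_cons_pair.
have [iF' eF] := integrable_product_cons mF iF.
split => //; rewrite [LHS]eF big_ord_recl -e1.
under eq_Rintegral do rewrite prod_cons_pair.
exact: Rintegral_tensor.
Qed.

(** The likelihood ratio of an i.i.d. sample is the product of the individual
    ratios. The relation between [m] and [m0] is an identity of integrals, so
    that it applies to two probabilities with densities as well as to a
    probability and the measure that carries its density. *)
Lemma ge0_integral_iter_product_density
    (m m0 : {sigma_finite_measure set T -> \bar R}) (g : T -> R) :
  measurable_fun setT g -> (forall x, 0 <= g x) ->
  (forall G : T -> \bar R, measurable_fun setT G -> (forall x, 0 <= G x)%E ->
    (\int[m]_x G x = \int[m0]_x (G x * (g x)%:E))%E) ->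
  forall (n : nat) (F : n.-tuple T -> \bar R), measurable_fun setT F ->
  (forall t, 0 <= F t)%E ->
  (\int[iter_product m n]_t F t =
   \int[iter_product m0 n]_t (F t * (\prod_(i < n) g (tnth t i))%:E))%E.
Proof.
move=> mg g0 dens; elim => [|n IH] F mF F0.
  by apply: eq_integral => t _; rewrite big_ord0 mule1.
have mP k : measurable_fun setT (fun t : k.-tuple T =>
    (\prod_(i < k) g (tnth t i))%:E).
  apply/measurable_EFinP.
  exact: (measurable_prod_tnth (G := fun=> g)).
have P0 k (t : k.-tuple T) : (0 <= (\prod_(i < k) g (tnth t i))%:E)%E.
  by rewrite lee_fin prodr_ge0.
rewrite [LHS]ge0_integral_product_cons// [RHS]ge0_integral_product_cons//;
  last 2 first.
- by apply: emeasurable_funM => //; exact: mP.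
- by move=> t; rewrite mule_ge0.
have mFc : measurable_fun setT (F \o @cons_pair _ T n).
  by apply: measurableT_comp => //; exact: measurable_cons_pair.
have mFx x : measurable_fun setT (fun t => F (cons_pair (x, t))).
  by apply: (measurableT_comp mFc); exact: measurable_pair1.
transitivity (\int[m]_x \int[iter_product m0 n]_t
    (F (cons_pair (x, t)) * (\prod_(i < n) g (tnth t i))%:E))%E.
  by apply: eq_integral => x _; rewrite IH.
rewrite dens; last 2 first.
- apply: (measurable_fun_fubini_tonelli_F (fun z =>
    F (cons_pair z) * (\prod_(i < n) g (tnth z.2 i))%:E)%E).
    apply: emeasurable_funM => //.
    by apply: (measurableT_comp (mP n)); exact: measurable_snd.
  by move=> z; rewrite mule_ge0 ?P0.
- by move=> x; apply: integral_ge0 => t _; rewrite mule_ge0.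
apply: eq_integral => x _; rewrite -ge0_integralZr//; last 3 first.
- by apply: emeasurable_funM => //; exact: mP.
- by move=> t _; rewrite mule_ge0.
- by rewrite lee_fin.
apply: eq_integral => t _; rewrite -muleA; congr (_ * _)%E.
rewrite -EFinM mulrC; congr EFin.
by rewrite (prod_cons_pair (fun=> g)).
Qed.

Lemma iter_product_setT (m : {sigma_finite_measure set T -> \bar R}) (n : nat) :
  m setT = 1%E -> iter_product m n setT = 1%E.
Proof.
move=> m1; have := @iter_product_rect _ T R m n (fun=> setT) (fun=>
  measurableT).
rewrite (_ : [set _ | _] = setT) => [->|]; last by apply/seteqP; split.
by apply: big1 => i _; exact: m1.
Qed.

End iter_product_integral.

Section parametric_integral.
Context d1 d2 (T1 : measurableType d1) (T2 : measurableType d2) (R : realType).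
Variable (m2 : {sigma_finite_measure set T2 -> \bar R}).

(** [Rintegral] is total, so it is enough that the integrals of the positive
    and negative parts are measurable in the parameter: this is Tonelli's
    theorem. *)
Lemma measurable_fun_Rintegral (f : T1 * T2 -> R) :
  measurable_fun setT f ->
  measurable_fun setT (fun x => \int[m2]_y f (x, y)).
Proof.
move=> mf; have mf' : measurable_fun setT (EFin \o f) by exact/measurable_EFinP.
apply: (measurableT_comp (fine_measurable measurableT)).
rewrite (_ : (fun x => _) = ((fun x => \int[m2]_y (EFin \o f)^\+ (x, y)) \-
    (fun x => \int[m2]_y (EFin \o f)^\- (x, y)))%E).
  apply: emeasurable_funB; apply: measurable_fun_fubini_tonelli_F => //.
  - exact: measurable_funepos.
  - exact: measurable_funeneg.
apply/funext=> x; rewrite integralE.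
by congr (_ - _)%E; apply: eq_integral => y _; rewrite ?funeposE ?funenegE.
Qed.

End parametric_integral.

Section lebesgue_norms.
Context d (T : measurableType d) (R : realType) (m : {measure set T -> \bar R}).
Local Open Scope ereal_scope.

Lemma Lnorm_oo_le (f : T -> R) (B : R) : (forall x, `|f x| <= B)%R ->
  (0 <= B)%R -> 'N[m]_+oo[EFin \o f] <= B%:E.
Proof.
move=> fB B0; rewrite unlock /Lnorm; case: ifPn => _; last by rewrite lee_fin.
by apply/ess_supP; apply/nearW => x; rewrite /= lee_fin.
Qed.

Lemma integral_powR2 (f : T -> R) :
  \int[m]_x (`|(f x)%:E| `^ 2) = \int[m]_x (f x ^+ 2)%:E.
Proof.
apply: eq_integral => x _.
by rewrite abse_EFin poweR_EFin powR_mulrn// -normrX ger0_norm// sqr_ge0.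
Qed.

Lemma Lfun2_sqr (f : T -> R) : measurable_fun setT f ->
  \int[m]_x (f x ^+ 2)%:E < +oo -> f \in Lfun m 2%:E.
Proof.
move=> mf i2; rewrite inE; apply/andP; split; rewrite inE//=.
by rewrite /finite_norm unlock /Lnorm integral_powR2 poweR_lty.
Qed.

(** A lower bound on the square integral is what the separation of a
    perturbation provides, whereas alternatives are defined by the norm. *)
Lemma lt_Lnorm2 (f : T -> R) (rho : R) : (0 <= rho)%R ->
  (rho ^+ 2)%:E < \int[m]_x (f x ^+ 2)%:E -> rho%:E < 'N[m]_2%:E[EFin \o f].
Proof.
move=> rho0 lt; rewrite ltNge; apply/negP => le.
have : 'N[m]_2%:E[EFin \o f] `^ 2 <= rho%:E `^ 2.
  by rewrite gt0_ler_poweR// in_itv/= leey andbT ?Lnorm_ge0.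
rewrite powR_Lnorm// integral_powR2 poweR_EFin powR_mulrn// leNgt.
by rewrite lt.
Qed.

End lebesgue_norms.

(** * Smooth bumps and their Fourier decay *)

Section smooth_bump.
Variable R : realType.
Local Notation mu := (@lebesgue_measure R).

Lemma FTC2_is_derive (f F : R -> R) (a b : R) : a < b -> continuous f ->
  (forall x, is_derive x (1 : R) F (f x)) ->
  \int[mu]_(x in `[a, b]) f x = F b - F a.
Proof.
move=> ab cf dF.
have dF1 x : derivable F x 1 by apply: ex_derive; exact: dF.
have cF x : {for x, continuous F}.
  exact/differentiable_continuous/derivable1_diffP.
rewrite /Rintegral (@continuous_FTC2 _ f F)//.
- exact: continuous_subspaceT.
- by split=> //; [exact/cvg_at_right_filter/cF|exact/cvg_at_left_filter/cF].
- by move=> x _; rewrite derive1E; apply: derive_val.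
Qed.

Lemma segment_integrable (f : R -> R) (a b : R) : continuous f ->
  mu.-integrable `[a, b] (EFin \o f).
Proof.
move=> cf; apply: continuous_compact_integrable; first exact: segment_compact.
exact: continuous_subspaceT.
Qed.

Definition affine_poly (m c : R) : {poly R} := m *: 'X - c%:P.

Lemma horner_affine_poly m c x : (affine_poly m c).[x] = m * x - c.
Proof. by rewrite /affine_poly !hornerE. Qed.

Lemma deriv_affine_poly m c : (affine_poly m c)^`() = m%:P.
Proof. by rewrite derivB derivZ derivX derivC subr0 alg_polyC. Qed.

(** The free phase [b] makes the family stable under differentiation, and
    covers the cosine ([b = 0]) and the sine ([b = - pi / 2]) at once. *)
Definition wave (P : {poly R}) (m c v b x : R) : R :=
  P.[m * x - c] * cos (v * x + b).

Lemma wave_is_derive P m c v b x :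
  is_derive x (1 : R) (wave P m c v b)
    (m * wave P^`() m c v b x + v * wave P m c v (b + pi / 2) x).
Proof.
have E : wave P m c v b =
    horner (P \Po affine_poly m c) * (cos \o horner (affine_poly v (- b))).
  apply/funext => t; rewrite /wave.
  rewrite -[RHS]/((P \Po affine_poly m c).[t] * cos (affine_poly v (- b)).[t]).
  by rewrite horner_comp !horner_affine_poly opprK.
rewrite E; apply: is_derive_eq.
rewrite /= deriv_comp hornerM !horner_comp !deriv_affine_poly !hornerC.
rewrite !horner_affine_poly opprK /wave addrA cosDpihalf /GRing.scale /=.
ring.
Qed.

Lemma continuous_wave P m c v b : continuous (wave P m c v b).
Proof.
move=> x; apply/differentiable_continuous/derivable1_diffP.
by apply: ex_derive; exact: wave_is_derive.
Qed.

Definition wave_integral (P : {poly R}) (m c v b : R) : R :=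
  \int[mu]_(x in `[c / m, (c + 1) / m]) wave P m c v b x.

(** The integral of the derivative of a wave over its cell is zero when [P]
    vanishes at both ends. Taking [v = 0] shows that [P^`()] then has integral
    zero as well. *)
Lemma wave_integral_by_parts P m c v b : 0 < m -> P.[0] = 0 -> P.[1] = 0 ->
  v * wave_integral P m c v (b + pi / 2) = - (m * wave_integral P^`() m c v b).
Proof.
move=> m0 P0 P1.
have lt : c / m < (c + 1) / m by rewrite ltr_pM2r ?invr_gt0// ltrDl.
have iw Q b' := @segment_integrable _ (c / m) ((c + 1) / m)
  (@continuous_wave Q m c v b').
have izw r Q b' : mu.-integrable `[c / m, (c + 1) / m]
    (EFin \o (fun x => r * wave Q m c v b' x)).
  by apply: segment_integrable => x; apply: cvgMr; exact: continuous_wave.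
apply/eqP; rewrite -addr_eq0 addrC -!RintegralZl// -RintegralD//.
have cf : continuous (fun x => m * wave P^`() m c v b x +
    v * wave P m c v (b + pi / 2) x).
  by move=> x; apply: cvgD; apply: cvgMr; exact: continuous_wave.
rewrite (FTC2_is_derive lt cf (wave_is_derive P m c v b)) /wave.
have -> : m * ((c + 1) / m) - c = 1 by field; rewrite gt_eqF.
have -> : m * (c / m) - c = 0 by field; rewrite gt_eqF.
by rewrite P0 P1 !mul0r subrr.
Qed.

Lemma wave_integralB P Q m c v b :
  wave_integral (P - Q) m c v b =
  wave_integral P m c v b - wave_integral Q m c v b.
Proof.
rewrite /wave_integral -RintegralB//.
- by apply: eq_Rintegral => x _; rewrite /wave hornerD hornerN mulrBl.
- exact/segment_integrable/continuous_wave.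
- exact/segment_integrable/continuous_wave.
Qed.

Lemma wave_integralNpi P m c v b :
  wave_integral P m c v (b - pi) = - wave_integral P m c v b.
Proof.
rewrite /wave_integral -[RHS]mulN1r -RintegralZl//; last first.
  exact/segment_integrable/continuous_wave.
apply: eq_Rintegral => x _; rewrite /wave mulN1r addrA.
by rewrite -[in RHS](subrK pi (v * x + b)) cosDpi mulrN opprK.
Qed.

(** Two integrations by parts multiply the integral by [- (v / m) ^+ 2] and
    differentiate [P] twice; adding the original integral gives a weight that
    does not vanish at the frequency 0. *)
Lemma wave_integral_decay P m c v b : 0 < m -> P.[0] = 0 -> P.[1] = 0 ->
  P^`().[0] = 0 -> P^`().[1] = 0 ->
  (1 + (v / m) ^+ 2) * wave_integral P m c v b =
  wave_integral (P - P^`(2)) m c v b.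
Proof.
move=> m0 P0 P1 P'0 P'1.
have h1 := wave_integral_by_parts c v (b - pi / 2) m0 P0 P1.
have h2 := wave_integral_by_parts c v (b - pi) m0 P'0 P'1.
move: h1 h2; rewrite subrK (_ : b - pi + pi / 2 = b - pi / 2); last by field.
rewrite -[P^`()^`()]/(P^`(2)) wave_integralNpi wave_integralB => h1 h2.
have m0' : m != 0 by rewrite gt_eqF.
have h3 : v ^+ 2 * wave_integral P m c v b =
    - (m ^+ 2 * wave_integral P^`(2) m c v b).
  rewrite expr2 -mulrA h1 mulrN mulrCA h2; ring.
rewrite expr_div_n mulrDl mul1r mulrAC h3; field.
by [].
Qed.

Lemma horner_bounded (P : {poly R}) :
  exists2 S : R, 0 < S & forall t, 0 <= t <= 1 -> `|P.[t]| <= S.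
Proof.
exists (1 + \sum_(i < size P) `|P`_i|).
  by rewrite ltr_pwDl// sumr_ge0.
move=> t /andP[t0 t1]; rewrite horner_coef.
apply: (le_trans (ler_norm_sum _ _ _)); apply: ler_wpDl => //.
apply: ler_sum => i _; rewrite normrM ler_piMr// normrX exprn_ile1//.
by rewrite ger0_norm.
Qed.

Lemma wave_integral_bounded (P : {poly R}) : exists2 S : R, 0 < S &
  forall m c v b, 0 < m -> `|wave_integral P m c v b| <= S / m.
Proof.
have [S S0 PS] := horner_bounded P; exists S => // m c v b m0.
have lt : c / m < (c + 1) / m by rewrite ltr_pM2r ?invr_gt0// ltrDl.
have iw := @segment_integrable _ (c / m) ((c + 1) / m)
  (@continuous_wave P m c v b).
apply: (le_trans (le_normr_Rintegral _ iw)) => //.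
apply: (@le_trans _ _ (\int[mu]_(x in `[c / m, (c + 1) / m]) S)).
  apply: le_Rintegral => //; first exact: integrable_norm.
    by apply: segment_integrable => ?; exact: cvg_cst.
  move=> x /=; rewrite in_itv/= ler_pdivrMr// ler_pdivlMr// => /andP[x1 x2].
  rewrite /wave normrM -[leRHS]mulr1 ler_pM ?cos_max// PS//.
  by rewrite subr_ge0 lerBlDl mulrC x1 x2.
rewrite Rintegral_cst//= lebesgue_measure_itv/= lte_fin lt -EFinB/=.
by rewrite -mulrBl addrAC subrr add0r div1r.
Qed.

(** Vanishing to order [k] at 0 and 1, stated as divisibility so that it passes
    to derivatives (with [k] lowered by one) by a purely formal computation. *)
Definition flat (k : nat) (P : {poly R}) : Prop :=
  exists A, P = ('X * (1 - 'X)) ^+ k * A.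

Lemma flat0 k P : flat k.+1 P -> P.[0] = 0 /\ P.[1] = 0.
Proof.
move=> [A ->]; rewrite !hornerM !horner_exp !hornerM !hornerD !hornerN.
by rewrite !hornerX !hornerC subrr mul0r mulr0 !expr0n /= !mul0r.
Qed.

Lemma flat_deriv k P : flat k.+1 P -> flat k P^`().
Proof.
move=> [A ->].
exists (('X * (1 - 'X))^`() * A *+ k.+1 + 'X * (1 - 'X) * A^`()).
rewrite [LHS]derivM deriv_exp [k.+1.-1]/= exprS.
move: ('X * (1 - 'X))^`() => W'; move: ('X * (1 - 'X)) => W.
by rewrite -[_ * _ *+ _]mulr_natr -[W' * A *+ _]mulr_natr; ring.
Qed.

Lemma flatB k P Q : flat k P -> flat k Q -> flat k (P - Q).
Proof. by move=> [A ->] [B ->]; exists (A - B); rewrite [RHS]mulrBr. Qed.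

Lemma flatS k P : flat k.+1 P -> flat k P.
Proof.
move=> [A ->]; exists ('X * (1 - 'X) * A).
by move: ('X * (1 - 'X)) => W; rewrite exprSr mulrA.
Qed.

(** Each use of [wave_integral_decay] replaces [P] by [P - P^`(2)] and costs
    two orders of vanishing, so the constant is a bound for a polynomial that
    depends on [P] and [k] only, hence is uniform in the scale [m]. *)
Lemma wave_integral_fast_decay (k : nat) (P : {poly R}) : flat k.*2 P ->
  exists2 S : R, 0 < S & forall m c v b, 0 < m ->
    (1 + (v / m) ^+ 2) ^+ k * `|wave_integral P m c v b| <= S / m.
Proof.
elim: k P => [|k IH] P flP.
  have [S S0 PS] := wave_integral_bounded P; exists S => // m c v b m0.
  by rewrite expr0 mul1r; exact: PS.
have [|S S0 PS] := IH (P - P^`(2)).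
  apply: flatB; first exact/flatS/flatS.
  exact/flat_deriv/flat_deriv.
exists S => // m c v b m0; apply: le_trans (PS m c v b m0).
have [P0 P1] := flat0 flP; have [P'0 P'1] := flat0 (flat_deriv flP).
rewrite -wave_integral_decay// normrM exprSr mulrA ger0_norm//.
by rewrite addr_ge0// sqr_ge0.
Qed.

(** The graph of [P] over the unit interval, shrunk to the cell from [c / m] to
    [(c + 1) / m]. Half open cells make bumps at different integers [c] exactly
    disjoint. *)
Definition cell_bump (P : {poly R}) (m c : R) : R -> R :=
  (fun x => P.[m * x - c]) \_ `[c / m, (c + 1) / m[.

Lemma cell_bumpE P m c x : 0 < m ->
  cell_bump P m c x = if c <= m * x < c + 1 then P.[m * x - c] else 0.
Proof.
move=> m0; rewrite /cell_bump patchE mem_setE in_itv/=.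
by rewrite ler_pdivrMr// ltr_pdivlMr// [x * m]mulrC.
Qed.

Lemma measurable_cell_bump P m c : measurable_fun setT (cell_bump P m c).
Proof.
apply/(measurable_restrictT _ _).1 => //; apply: measurable_funTS.
apply: (@measurableT_comp _ _ _ _ _ _ (horner P)).
  by apply: continuous_measurable_fun; exact: continuous_horner.
by apply: measurable_funB => //; apply: measurable_funM.
Qed.

Lemma cell_bump_disjoint P m (i j : nat) x : 0 < m -> i != j ->
  cell_bump P m i%:R x * cell_bump P m j%:R x = 0.
Proof.
move=> m0 ij; rewrite !cell_bumpE// -!(natrD _ _ 1%N) !addn1.
case: ifPn => [/andP[i1 i2]|]; last by rewrite mul0r.
case: ifPn => [/andP[j1 j2]|]; last by rewrite mulr0.
have := le_lt_trans i1 j2; have := le_lt_trans j1 i2.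
rewrite !ltr_nat !ltnS => ji ij'; move: ij; rewrite neq_ltn.
by rewrite !ltnNge ji ij'.
Qed.

Lemma integral_bump_wave P m c v b :
  mu.-integrable setT (fun x => (cell_bump P m c x * cos (v * x + b))%:E) /\
  \int[mu]_x (cell_bump P m c x * cos (v * x + b)) = wave_integral P m c v b.
Proof.
have e : (fun x => cell_bump P m c x * cos (v * x + b)) =
    wave P m c v b \_ `[c / m, (c + 1) / m[.
  apply/funext => x; rewrite /cell_bump !patchE /wave.
  by case: ifPn => _ //; rewrite mul0r.
have iw : mu.-integrable `[c / m, (c + 1) / m[ (EFin \o wave P m c v b).
  apply: (@integrableS _ _ _ mu `[c / m, (c + 1) / m]) => //.
    by apply: subset_itvl; rewrite bnd_simp.
  exact/segment_integrable/continuous_wave.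
split.
  rewrite (_ : (fun x => _) = EFin \o (wave P m c v b \_ `[c / m, (c + 1) /
    m[)).
    by rewrite -restrict_EFin; apply/(integrable_mkcond _ _).1.
  by rewrite -e.
rewrite e -Rintegral_mkcond Rintegral_itv_bndo_bndc//.
Qed.

Lemma integrable_cell_bump P m c : mu.-integrable setT (EFin \o cell_bump P m
  c).
Proof.
have [i _] := integral_bump_wave P m c 0 0; apply: eq_integrable i => // x _.
by rewrite mul0r addr0 cos0 mulr1.
Qed.

Lemma integral_bump_deriv Q m c : 0 < m -> Q.[0] = 0 -> Q.[1] = 0 ->
  \int[mu]_x cell_bump Q^`() m c x = 0.
Proof.
move=> m0 Q0 Q1; have [_] := integral_bump_wave Q^`() m c 0 0.
under eq_Rintegral do rewrite mul0r addr0 cos0 mulr1.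
move=> ->; have := wave_integral_by_parts c 0 0 m0 Q0 Q1.
rewrite mul0r => /esym/eqP; rewrite oppr_eq0 mulf_eq0 gt_eqF//=.
by move=> /eqP.
Qed.

(** Only the order of magnitude [1 / m] matters; the lower bound comes from an
    eighth of the cell, on which [P] is bounded away from 0. *)
Lemma bump_sqr_bounds (P : {poly R}) (S l : R) :
  (forall t, 0 <= t <= 1 -> `|P.[t]| <= S) ->
  (forall t, 8^-1 <= t <= 4^-1 -> l <= P.[t]) -> 0 <= l ->
  forall m c, 0 < m ->
  ((l ^+ 2 / 8 / m)%:E <= \int[mu]_x ((cell_bump P m c x) ^+ 2)%:E <=
   (S ^+ 2 / m)%:E)%E.
Proof.
move=> PS lP l0 m c m0.
have S0 : 0 <= S.
  by apply: (le_trans (normr_ge0 P.[0])); apply: PS; rewrite lexx ler01.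
have mb : measurable_fun setT (fun x => ((cell_bump P m c x) ^+ 2)%:E).
  by apply/measurable_EFinP; apply: measurable_funX; exact:
    measurable_cell_bump.
have cm : c / m < (c + 1) / m by rewrite ltr_pM2r ?invr_gt0// ltrDl.
apply/andP; split; last first.
  apply: (@le_trans _ _ (\int[mu]_(x in `[(c / m)%R, ((c + 1) / m)%R[)
      (S ^+ 2)%:E)%E).
    rewrite [leRHS]integral_mkcond; apply: ge0_le_integral => //.
    - by move=> x _; rewrite lee_fin sqr_ge0.
    - by apply/(measurable_restrictT _ _).1 => //; exact: measurable_cst.
    - move=> x _; rewrite patchE /cell_bump patchE; case: ifPn => [|_].
        rewrite mem_setE in_itv/= ler_pdivrMr// ltr_pdivlMr// [x * m]mulrC.
        move=> /andP[x1 x2]; rewrite lee_fin -real_normK ?num_real//.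
        rewrite ler_pXn2r ?nnegrE//; apply: PS.
        by rewrite subr_ge0 lerBlDl x1 ltW.
      by rewrite expr0n.
  rewrite integral_cst//= lebesgue_measure_itv/= lte_fin cm -EFinB -EFinM.
  by rewrite lee_fin -mulrBl addrAC subrr add0r div1r.
have cm' : (c + 8^-1) / m < (c + 4^-1) / m.
  by rewrite ltr_pM2r ?invr_gt0//; lra.
apply: (@le_trans _ _ (\int[mu]_(x in `[((c + 8^-1) / m)%R, ((c + 4^-1) / m)%R])
    (l ^+ 2)%:E)%E).
  rewrite integral_cst//= lebesgue_measure_itv/= lte_fin cm' -EFinB -EFinM.
  by rewrite lee_fin -mulrBl -mulrA ler_wpM2l ?sqr_ge0// ler_pM2r ?invr_gt0//;
    lra.
rewrite integral_mkcond; apply: ge0_le_integral => //.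
- by move=> x _; rewrite patchE; case: ifPn => // _; rewrite lee_fin sqr_ge0.
- by apply/(measurable_restrictT _ _).1 => //; exact: measurable_cst.
- move=> x _; rewrite patchE; case: ifPn => [|_]; last by rewrite lee_fin
  sqr_ge0.
  rewrite mem_setE in_itv/= ler_pdivrMr// ler_pdivlMr// [x * m]mulrC.
  move=> /andP[x1 x2]; rewrite cell_bumpE// ifT; last first.
    by apply/andP; split; lra.
  by rewrite lee_fin ler_pXn2r ?nnegrE// ?(le_trans l0)//; apply: lP;
    apply/andP; split; lra.
Qed.

(** The derivative of [atan] rescaled: it dominates the weighted squared
    transform of a bump, and its integral does not depend on the scale. *)
Lemma integral_cauchy_kernel (m : R) : 0 < m ->
  (\int[mu]_u (m^-1 * (1 + (u / m) ^+ 2)^-1)%:E = pi%:E)%E.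
Proof.
move=> m0; pose F (u : R) := u * m^-1.
have dF x : is_derive x (1 : R) F m^-1.
  rewrite (_ : F = horner (m^-1 *: 'X)); last first.
    by apply/funext => y; rewrite !hornerE /F mulrC.
  by apply: is_derive_eq; rewrite derivZ derivX alg_polyC hornerC.
have F' : (F^`())%classic = cst m^-1.
  by apply/funext => x; rewrite derive1E; apply: derive_val.
have cO : continuous (fun x : R => (oneDsqr x)^-1).
  by move=> x; exact: continuous_oneDsqrV.
have O0 x : 0 <= (oneDsqr x : R)^-1.
  by rewrite invr_ge0 (le_trans ler01)// oneDsqr_ge1.
transitivity (\int[mu]_x (oneDsqr x)^-1%:E)%E.
  rewrite [RHS](@increasing_ge0_integration_by_substitutionT _ F)//.
  - apply: eq_integral => x _; rewrite F'.
    by rewrite -[RHS]/(((oneDsqr (F x))^-1 * m^-1)%:E) mulrC.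
  - by move=> x y xy; rewrite /F ltr_pM2r// invr_gt0.
  - by rewrite F'; exact: cst_continuous.
  - by rewrite F'; exact: is_cvg_cst.
  - by rewrite F'; exact: is_cvg_cst.
  - by apply: gt0_cvgMlNy; rewrite ?invr_gt0//; exact: cvg_id.
  - by apply: gt0_cvgMly; rewrite ?invr_gt0//; exact: cvg_id.
rewrite ge0_symfun_integralT//.
  rewrite -set_itvcy integral0y_oneDsqr -EFinM; congr EFin; by field.
by move=> x; rewrite /= /oneDsqr sqrrN.
Qed.

(** The derivative of a high power of [X (1 - X)] has integral zero on [0, 1]
    and vanishes to a high order at the end points. It is positive near 0, and
    between 1/8 and 1/4 the factors [1 - 2 t] and [t (1 - t)] are at least 1/2
    and 1/16. *)
Lemma exists_bump (k : nat) : exists P : {poly R}, exists l S D : R,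
  [/\ 0 < l, 0 < S & 0 < D] /\
  forall m c, 0 < m ->
  [/\ forall x, `|cell_bump P m c x| <= S,
      \int[mu]_x cell_bump P m c x = 0,
      ((l / m)%:E <= \int[mu]_x ((cell_bump P m c x) ^+ 2)%:E <= (S ^+ 2 /
        m)%:E)%E &
      forall v b, `|\int[mu]_x (cell_bump P m c x * cos (v * x + b))| <=
        D / m / (1 + (v / m) ^+ 2) ^+ k].
Proof.
pose Q : {poly R} := ('X * (1 - 'X)) ^+ k.*2.+1; pose P := Q^`().
have flQ : flat k.*2.+1 Q by exists 1; rewrite mulr1.
have [Q0 Q1] := flat0 flQ.
have [S S0 PS] := horner_bounded P.
have [D D0 PD] := wave_integral_fast_decay (flat_deriv flQ).
pose l : R := 2^-1 * 16^-1 ^+ k.*2.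
have l0 : 0 < l by rewrite mulr_gt0// ?exprn_gt0// invr_gt0.
have lP (t : R) : 8^-1 <= t <= 4^-1 -> l <= P.[t].
  move=> /andP[t1 t2]; rewrite /P /Q deriv_exp hornerMn hornerM horner_exp.
  rewrite derivM derivX derivB derivX derivC mul1r sub0r mulrN1.
  rewrite !hornerM !hornerD !hornerN !hornerX !hornerC.
  apply: (@le_trans _ _ ((1 - t - t) * (t * (1 - t)) ^+ k.*2)); last first.
    rewrite [_.-1]/= mulrS lerDl mulrn_wge0// mulr_ge0//.
      by lra.
    by rewrite exprn_ge0// mulr_ge0//; lra.
  rewrite /l; apply: ler_pM; first by lra.
  - by rewrite exprn_ge0//; lra.
  - by lra.
  - rewrite lerXn2r// ?nnegrE; [by lra|by rewrite mulr_ge0//; lra|].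
    have h : 8^-1 * 2^-1 <= t * (1 - t) by apply: ler_pM; lra.
    by apply: le_trans h; rewrite -invfM -natrM.
exists P, (l ^+ 2 / 8), S, D; split.
  by split => //; rewrite divr_gt0// exprn_gt0.
move=> m c m0; split.
- move=> x; rewrite cell_bumpE//; case: ifPn => [/andP[x1 x2]|_].
    by apply: PS; rewrite subr_ge0 lerBlDl x1 ltW.
  by rewrite normr0 ltW.
- exact: integral_bump_deriv.
- by apply: bump_sqr_bounds => //; exact: ltW.
- move=> v b; have [_ ->] := integral_bump_wave P m c v b.
  rewrite ler_pdivlMr; first by rewrite mulrC; exact: PD.
  by rewrite exprn_gt0// ltr_pwDl// sqr_ge0.
Qed.

End smooth_bump.

(** * Random signs *)

Section random_signs.
Variables (R : realType) (K : finType).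
Implicit Types (th : {ffun K -> bool}) (a c : K -> R).

Definition sgn th (k : K) : R := (-1) ^+ th k.

Lemma sgn_sqr th k : sgn th k * sgn th k = 1.
Proof. by rewrite /sgn; case: (th k); rewrite ?mulrNN mulr1. Qed.

Lemma normr_sgn th k : `|sgn th k| = 1.
Proof. exact: normr_sign. Qed.

Definition flip (k : K) th : {ffun K -> bool} :=
  [ffun l => if l == k then ~~ th l else th l].

Lemma flipK k : involutive (flip k).
Proof.
by move=> th; apply/ffunP => l; rewrite !ffunE; case: eqP => //; rewrite negbK.
Qed.

(** Flipping one sign is an involution that changes the sign of the product, so
    distinct signs are orthogonal. *)
Lemma sum_sgn_sgn k l :
  \sum_th sgn th k * sgn th l = (k == l)%:R * #|{ffun K -> bool}|%:R.
Proof.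
have [<-|kl] := eqVneq k l.
  by under eq_bigr do rewrite sgn_sqr; rewrite sumr_const mul1r.
suff /eqP : \sum_th sgn th k * sgn th l = - \sum_th sgn th k * sgn th l.
  by rewrite -subr_eq0 opprK -mulr2n mulrn_eq0 /= mul0r => /eqP.
rewrite [LHS](reindex_inj (inv_inj (flipK k)))/= -sumrN.
apply: eq_bigr => th _.
rewrite /sgn !ffunE eqxx [l == k]eq_sym (negbTE kl).
by rewrite signrN mulNr.
Qed.

(** Only the diagonal terms survive. Averaging over the signs thus makes the
    spectral energy of a sum of many bumps the sum of their energies, although
    their transforms all overlap. *)
Lemma sum_sgn_sqr c :
  \sum_th (\sum_k sgn th k * c k) ^+ 2 =
  #|{ffun K -> bool}|%:R * \sum_k c k ^+ 2.
Proof.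
under eq_bigr do rewrite expr2 big_distrlr /=.
rewrite exchange_big /= big_distrr /=; apply: eq_bigr => k _.
rewrite exchange_big /= (bigD1 k)//= [X in _ + X]big1 ?addr0 => [|l lk].
  under eq_bigr do rewrite mulrACA sgn_sqr mul1r.
  by rewrite sumr_const expr2 mulr_natl.
under eq_bigr do rewrite mulrACA.
by rewrite -big_distrl /= sum_sgn_sgn eq_sym (negbTE lk) !mul0r.
Qed.

(** The elementary bound [expR y <= 1 + y + 2 y^2] near 0 follows from [expR y
    <= 1 / (1 - y)]; adding its two signs cancels the linear terms. *)
Lemma cosh_le (x : R) : `|x| <= 2^-1 -> expR x + expR (- x) <= 2 * expR (2 * x
  ^+ 2).
Proof.
have h (y : R) : `|y| <= 2^-1 -> expR y <= 1 + y + 2 * y ^+ 2.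
  rewrite ler_norml => /andP[y1 y2].
  have : (1 - y) * expR y <= 1.
    rewrite -[leRHS](expRxMexpNx_1 y) mulrC ler_wpM2l ?expR_ge0//.
    exact: expR_ge1Dx.
  have : 1 <= (1 - y) * (1 + y + 2 * y ^+ 2) by nra.
  move=> h1 h2; have := le_trans h2 h1; rewrite ler_pM2l//; lra.
move=> hx; have h1 := h x hx; have h2 := h (- x); rewrite normrN in h2.
have {}h2 := h2 hx; have := expR_ge1Dx (2 * x ^+ 2); nra.
Qed.

(** Independence of the signs: the exponential of the sum is a product, whose
    sum over all sign patterns is a product of hyperbolic cosines. *)
Lemma sum_exp_sgn a : (forall k, `|a k| <= 2^-1) ->
  \sum_th expR (\sum_k a k * sgn th k) <=
  #|{ffun K -> bool}|%:R * expR (2 * \sum_k a k ^+ 2).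
Proof.
move=> a2; pose e k (b : bool) := expR (a k * (-1) ^+ b).
rewrite [leLHS](_ : _ = \prod_k \sum_b e k b); last first.
  rewrite bigA_distr_bigA /=; apply: eq_bigr => th _.
  by rewrite expR_sum.
rewrite card_ffun card_bool natrX -prodr_const big_distrr /= expR_sum
  -big_split /=.
apply: ler_prod => k _; rewrite big_bool /e /= expr1 expr0 mulr1 mulrN1 addrC.
by rewrite addr_ge0 ?expR_ge0//= cosh_le.
Qed.

End random_signs.

(** * Fourier transforms of products *)

Section bounded_factor.
Context d (T : measurableType d) (R : realType) (m : {measure set T -> \bar R}).

Lemma integrable_mul_bounded (f h : T -> R) (B : R) :
  m.-integrable setT (EFin \o f) -> measurable_fun setT h ->
  (forall x, `|h x| <= B) ->
  m.-integrable setT (fun x => (f x * h x)%:E).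
Proof.
move=> i_f mh hB; apply: (integrableMl measurableT i_f mh).
exists B; split; first exact: num_real.
by move=> y By x _; apply: le_trans (hB x) (ltW By).
Qed.

End bounded_factor.

Section fourier_of_product.
Variable R : realType.
Local Notation mu := (@lebesgue_measure R).
Local Notation RR := (measurableTypeR R).

Definition phase (d : nat) (v : 'I_d -> R) (x : d.-tuple RR) : R :=
  \sum_(i < d) (tnth x i : R) * v i.

Lemma measurable_phase d (v : 'I_d -> R) : measurable_fun setT (phase v).
Proof.
apply: measurable_sum => i; apply: measurable_funM => //.
exact: measurable_tnth.
Qed.

Lemma measurable_cos_phase d (v : 'I_d -> R) b :
  measurable_fun setT (fun x : d.-tuple RR => cos (phase v x + b)).
Proof.
apply: measurableT_comp.
  by apply: continuous_measurable_fun; exact: continuous_cos.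
by apply: measurable_funD => //; exact: measurable_phase.
Qed.

Lemma phase_cons d (v : 'I_d.+1 -> R) (z : RR * d.-tuple RR) :
  phase v (cons_pair z) =
  (z.1 : R) * v ord0 + phase (fun i => v (lift ord0 i)) z.2.
Proof.
rewrite /phase big_ord_recl; congr (_ + _).
by apply: eq_bigr => i _; rewrite tnthS.
Qed.

(** The real ([b = 0]) and imaginary ([b = - pi / 2]) parts of the Fourier
    transform of a product function; the shift [b] plays the role of a
    multiplication by a complex number of modulus 1. *)
Definition cos_transform (d : nat) (G : 'I_d -> R -> R) (v : 'I_d -> R) (b : R)
  : R :=
  \int[lebesgue R d]_x (\prod_(i < d) G i (tnth x i) * cos (phase v x + b)).

Lemma integrable_cos_transform (d : nat) (G : 'I_d -> R -> R) v b :
  (forall i, mu.-integrable setT (EFin \o G i)) ->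
  (lebesgue R d).-integrable setT
    (fun x => (\prod_(i < d) G i (tnth x i) * cos (phase v x + b))%:E).
Proof.
move=> iG; apply: (@integrable_mul_bounded _ _ _ (lebesgue R d)
  (fun x => \prod_(i < d) G i (tnth x i)) (fun x => cos (phase v x + b)) 1).
- by have [] := integrable_iter_product_prod iG.
- exact: measurable_cos_phase.
- by move=> x; exact: cos_max.
Qed.

(** The addition formula for the cosine separates the first coordinate: this is
    the multiplicativity of the complex exponential in real form. *)
Lemma cos_transform_cons (d : nat) (G : 'I_d.+1 -> R -> R) v b :
  (forall i, mu.-integrable setT (EFin \o G i)) ->
  let G' i := G (lift ord0 i) in let v' i := v (lift ord0 i) in
  cos_transform G v b =
    (\int[mu]_x (G ord0 x * cos (v ord0 * x))) * cos_transform G' v' b -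
    (\int[mu]_x (G ord0 x * cos (v ord0 * x - pi / 2))) *
      cos_transform G' v' (b - pi / 2).
Proof.
move=> iG G' v'.
have ic c := @integrable_cos_transform _ G' v' c (fun i => iG (lift ord0 i)).
have i1 c : mu.-integrable setT (fun x => (G ord0 x * cos (v ord0 * x + c))%:E).
  apply: (@integrable_mul_bounded _ _ _ mu _
    (fun x => cos (v ord0 * x + c)) 1) => //.
    apply: measurableT_comp.
      by apply: continuous_measurable_fun; exact: continuous_cos.
    by apply: measurable_funD => //; exact: measurable_funM.
  by move=> x; exact: cos_max.
have i10 : mu.-integrable setT (fun x => (G ord0 x * cos (v ord0 * x))%:E).
  by apply: eq_integrable (i1 0) => // x _; rewrite addr0.
rewrite -!Rintegral_tensor//; last 3 first.
- exact: (i1 (- (pi / 2))).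
- exact: ic.
- exact: ic.
have mF : measurable_fun setT (fun x : d.+1.-tuple RR =>
    \prod_(i < d.+1) G i (tnth x i) * cos (phase v x + b)).
  apply: measurable_funM; last exact: measurable_cos_phase.
  apply: measurable_prod_tnth => i.
  by apply/measurable_EFinP; exact: (measurable_int _ (iG i)).
have E (z : RR * d.-tuple RR) :
    \prod_(i < d.+1) G i (tnth (cons_pair z) i) * cos (phase v (cons_pair z) +
      b)
    = tensor (fun x => G ord0 x * cos (v ord0 * x))
        (fun x => \prod_(i < d) G' i (tnth x i) * cos (phase v' x + b)) z -
      tensor (fun x => G ord0 x * cos (v ord0 * x - pi / 2))
        (fun x => \prod_(i < d) G' i (tnth x i) * cos (phase v' x + (b - pi /
          2))) z.
  rewrite prod_cons_pair phase_cons /tensor.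
  have cs y : cos (y - pi / 2) = sin y by rewrite -sinDpihalf subrK.
  rewrite addrA !cs -addrA [v ord0 * _]mulrC /G' /v'.
  move: (\prod_(_ < _) _) (phase _ _) => X Y.
  by rewrite [in LHS]cosD; ring.
have iT := integrable_tensor i10 (ic b).
have iT' := integrable_tensor (i1 (- (pi / 2))) (ic (b - pi / 2)).
rewrite -RintegralB//.
have iF : (mu \x lebesgue R d)%E.-integrable setT (fun z : RR * d.-tuple RR =>
    (\prod_(i < d.+1) G i (tnth (cons_pair z) i) *
     cos (phase v (cons_pair z) + b))%:E).
  apply: eq_integrable (integrableB measurableT iT iT') => // z _.
  by rewrite E.
have [_ eF] := integrable_product_cons mF iF.
by rewrite [LHS]eF; apply: eq_Rintegral => z _; rewrite E.
Qed.

(** The modulus of the transform of a product is the product of the moduli. The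
    inductive step is the identity [(a x - b y)^2 + (a y + b x)^2 = (a^2 + b^2)
    (x^2 + y^2)]. *)
Lemma cos_transform_sqr (d : nat) (G : 'I_d -> R -> R) v :
  (forall i, mu.-integrable setT (EFin \o G i)) ->
  cos_transform G v 0 ^+ 2 + cos_transform G v (- (pi / 2)) ^+ 2 =
  \prod_(i < d) ((\int[mu]_x (G i x * cos (v i * x))) ^+ 2 +
                 (\int[mu]_x (G i x * cos (v i * x - pi / 2))) ^+ 2).
Proof.
elim: d G v => [|d IH] G v iG.
  have e b : cos_transform G v b = cos b.
    rewrite /cos_transform /Rintegral /= integral_dirac//.
      by rewrite diracT mul1e /= !big_ord0 mul1r /phase big_ord0 add0r.
    apply/measurable_EFinP; apply: measurable_funM.
      by apply: measurable_prod => -[].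
    exact: measurable_cos_phase.
  by rewrite big_ord0 !e cosN cos_pihalf cos0 expr1n expr0n addr0.
rewrite big_ord_recl -IH// !cos_transform_cons// sub0r.
rewrite (_ : - (pi / 2) - pi / 2 = 0 - pi :> R); last by field.
set G' := fun i => G (lift ord0 i); set v' := fun i => v (lift ord0 i).
have -> : cos_transform G' v' (0 - pi) = - cos_transform G' v' 0.
  rewrite /cos_transform -[RHS]mulN1r -RintegralZl//; last first.
    by apply: integrable_cos_transform => i; exact: iG.
  apply: eq_Rintegral => x _; rewrite mulN1r addrA.
  by rewrite -[in RHS](subrK pi (phase v' x + 0)) cosDpi mulrN opprK.
by ring.
Qed.

End fourier_of_product.

(** * Cells and the uniform density *)

Section bump_systems.
Variable R : realType.
Local Notation mu := (@lebesgue_measure R).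
Local Notation RR := (measurableTypeR R).

(** One row of [M] bumps at scale [1 / M]. The constants [S], [l] and [D] of
    the size, the energy and the Fourier decay do not depend on [M], which is
    what the rate rests on; [k] is the order of the decay. *)
Record bump_system (M : nat) (S l D : R) (k : nat) := BumpSystem {
  bump_fun :> 'I_M -> R -> R;
  bump_fun_le : forall j x, `|bump_fun j x| <= S;
  bump_fun_support : forall j x, bump_fun j x != 0 -> 0 <= x <= 1;
  bump_fun_disjoint : forall i j x, i != j -> bump_fun i x * bump_fun j x = 0;
  bump_fun_integrable : forall j, mu.-integrable setT (EFin \o bump_fun j);
  bump_fun_integral0 : forall j, \int[mu]_x bump_fun j x = 0;
  bump_fun_sqr : forall j,
    ((l / M%:R)%:E <= \int[mu]_x (bump_fun j x ^+ 2)%:E <= (S ^+ 2 /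
      M%:R)%:E)%E;
  bump_fun_fourier : forall j v b,
    `|\int[mu]_x (bump_fun j x * cos (v * x + b))| <=
    D / M%:R / (1 + (v / M%:R) ^+ 2) ^+ k }.

Lemma exists_bump_system (k : nat) : exists S l D : R,
  [/\ 0 < S, 0 < l & 0 < D] /\
  forall M, (0 < M)%N -> inhabited (bump_system M S l D k).
Proof.
have [P [l [S [D [[l0 S0 D0] PP]]]]] := exists_bump R k.
exists S, l, D; split=> // M M0; have m0 : (0 : R) < M%:R by rewrite ltr0n.
constructor; apply: (@BumpSystem M S l D k
  (fun j => cell_bump P M%:R (j : nat)%:R)).
- by move=> j x; have [] := PP _ j%:R m0.
- move=> j x; rewrite cell_bumpE//; case: ifPn; rewrite ?eqxx// => /andP[x1 x2]
  _.
  have x0 : 0 <= x.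
    by rewrite -(pmulr_rge0 _ m0) (le_trans _ x1).
  rewrite x0 /= -(ler_pM2l m0) mulr1 (le_trans (ltW x2))//.
  by rewrite -(natrD _ _ 1%N) ler_nat addn1.
- by move=> i j x ij; exact: cell_bump_disjoint.
- by move=> j; exact: integrable_cell_bump.
- by move=> j; have [] := PP _ j%:R m0.
- by move=> j; have [] := PP _ j%:R m0.
- by move=> j; have [] := PP _ j%:R m0.
Qed.

End bump_systems.

Section cells.
Variables (R : realType) (M : nat) (S l D : R) (k : nat).
Variable w : bump_system M S l D k.
Local Notation mu := (@lebesgue_measure R).
Local Notation RR := (measurableTypeR R).

Lemma measurable_bump_fun j : measurable_fun setT (w j).
Proof.
by apply/measurable_EFinP; exact: (measurable_int _ (bump_fun_integrable w j)).
Qed.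

Definition cell (e : nat) (c : 'I_e -> 'I_M) (x : e.-tuple RR) : R :=
  \prod_(i < e) w (c i) (tnth x i).

Lemma measurable_cell e (c : 'I_e -> 'I_M) : measurable_fun setT (cell c).
Proof.
apply: (measurable_prod_tnth (G := fun i => w (c i))) => i.
exact: measurable_bump_fun.
Qed.

Lemma cell_le e (c : 'I_e -> 'I_M) x : `|cell c x| <= S ^+ e.
Proof.
rewrite /cell normr_prod -[e in leRHS]card_ord -prodr_const.
by apply: ler_prod => i _; rewrite normr_ge0 bump_fun_le.
Qed.

Lemma cell_support e (c : 'I_e -> 'I_M) x : cell c x != 0 ->
  forall i, 0 <= (tnth x i : R) <= 1.
Proof.
by move=> /prodf_neq0 c0 i; apply: (@bump_fun_support _ _ _ _ _ _ w (c i));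
  exact: c0.
Qed.

Lemma cell_disjoint e (c c' : {ffun 'I_e -> 'I_M}) x : c != c' ->
  cell c x * cell c' x = 0.
Proof.
move=> cc'; have [i ci] : exists i, c i != c' i.
  apply/existsP; move: cc'; apply: contraR; rewrite negb_exists => /forallP h.
  by apply/eqP/ffunP => i; apply/eqP; move: (h i); rewrite negbK.
rewrite /cell -big_split /= (bigD1 i)//= (bump_fun_disjoint w _ ci).
by rewrite mul0r.
Qed.

Lemma cell_integrable e (c : 'I_e -> 'I_M) :
  (lebesgue R e).-integrable setT (EFin \o cell c).
Proof.
by have [] := integrable_iter_product_prod (fun i => bump_fun_integrable w (c
  i)).
Qed.

Lemma cell_integral0 e (c : 'I_e -> 'I_M) : (0 < e)%N ->
  \int[lebesgue R e]_x cell c x = 0.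
Proof.
case: e c => // e c _.
have [_] := integrable_iter_product_prod (fun i => bump_fun_integrable w (c i)).
rewrite /cell /= => ->.
by rewrite big_ord_recl bump_fun_integral0 mul0r.
Qed.

Lemma cell_sqr e (c : 'I_e -> 'I_M) : 0 < l ->
  (((l / M%:R) ^+ e)%:E <= \int[lebesgue R e]_x (cell c x ^+ 2)%:E
    <= ((S ^+ 2 / M%:R) ^+ e)%:E)%E.
Proof.
move=> l0; under eq_integral do rewrite /cell -prodrXl.
rewrite [X in (_ <= X <= _)%E](ge0_integral_iter_product_prod mu
  (G := fun i x => w (c i) x ^+ 2)); last 2 first.
- by move=> i; apply: measurable_funX; exact: measurable_bump_fun.
- by move=> i x; exact: sqr_ge0.
have fi i : (\int[mu]_x (w (c i) x ^+ 2)%:E)%E =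
    (fine (\int[mu]_x (w (c i) x ^+ 2)%:E)%E)%:E.
  have /andP[h1 h2] := bump_fun_sqr w (c i).
  rewrite fineK// ge0_fin_numE ?(le_lt_trans h2) ?ltry//.
  by apply: integral_ge0 => x _; rewrite lee_fin sqr_ge0.
under eq_bigr do rewrite fi.
rewrite prodEFin !lee_fin -[e in (l / _) ^+ e]card_ord.
rewrite -[e in (S ^+ 2 / _) ^+ e]card_ord -!prodr_const.
apply/andP; split; apply: ler_prod => i _.
  rewrite divr_ge0// ?(ltW l0)//=.
  by have /andP[+ _] := bump_fun_sqr w (c i); rewrite fi lee_fin.
apply/andP; split.
  by rewrite fine_ge0// integral_ge0// => x _; rewrite lee_fin sqr_ge0.
by have /andP[_ +] := bump_fun_sqr w (c i); rewrite fi lee_fin.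
Qed.

End cells.

Section cube.
Variable R : realType.
Local Notation mu := (@lebesgue_measure R).
Local Notation RR := (measurableTypeR R).

(** The unperturbed law is uniform on [[0, 2]^e] rather than on the unit cube
    that carries the perturbation: its density is at most 1/2 for [e > 0],
    which leaves room for the perturbation even when the sup norm bound is 1.
    *)
Definition half_indicator (x : R) : R := 2^-1 * \1_(`[0, 2] : set R) x.

Definition cube (e : nat) (x : e.-tuple RR) : R :=
  \prod_(i < e) half_indicator (tnth x i).

Lemma half_indicator_bounds x : 0 <= half_indicator x <= 2^-1.
Proof.
by rewrite /half_indicator indicE; case: (x \in _); rewrite ?mulr1 ?mulr0 ?lexx
  invr_ge0 // ler0n.
Qed.

Lemma measurable_half_indicator : measurable_fun setT half_indicator.
Proof. by apply: measurable_funM. Qed.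

Lemma measurable_cube e : measurable_fun setT (@cube e).
Proof.
by apply: (measurable_prod_tnth (G := fun=> half_indicator)) => i;
  exact: measurable_half_indicator.
Qed.

Lemma cube_ge0 e (x : e.-tuple RR) : 0 <= cube x.
Proof. by apply: prodr_ge0 => i _; have /andP[] := half_indicator_bounds (tnth
  x i). Qed.

Lemma cube_le e (x : e.-tuple RR) : cube x <= 2^-1 ^+ e.
Proof.
rewrite -[e in leRHS]card_ord -prodr_const.
by apply: ler_prod => i _; exact: half_indicator_bounds.
Qed.

Lemma cube_unit e (x : e.-tuple RR) :
  (forall i, 0 <= (tnth x i : R) <= 1) -> cube x = 2^-1 ^+ e.
Proof.
move=> x01; rewrite -[e in RHS]card_ord -prodr_const; apply: eq_bigr => i _.
rewrite /half_indicator indicE mem_set ?mulr1//= in_itv/=.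
by have /andP[-> /le_trans->//] := x01 i; rewrite ler1n.
Qed.

Lemma integral_cube e : (\int[lebesgue R e]_x (cube x)%:E = 1)%E.
Proof.
rewrite [LHS](ge0_integral_iter_product_prod mu (G := fun=> half_indicator)).
- apply: big1 => i _; rewrite /half_indicator.
  under eq_integral do rewrite EFinM.
  rewrite ge0_integralZl//; last exact/measurable_EFinP.
  rewrite integral_indic// setIT/= lebesgue_measure_itv/= lte_fin ltr0n/=.
  by rewrite -EFinB subr0 -EFinM mulVf.
- by move=> i; exact: measurable_half_indicator.
- by move=> i x; have /andP[] := half_indicator_bounds x.
Qed.

Definition cube_density e : density (lebesgue R e) :=
  Density (@measurable_cube e) (@cube_ge0 e) (integral_cube e).

End cube.

(** * Perturbed densities *)

Section perturbation.
Variables (R : realType) (M : nat) (S l D : R) (k : nat).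
Variable w : bump_system M S l D k.
Variables (p q : nat) (gam : R).
Hypotheses (p0 : (0 < p)%N) (q0 : (0 < q)%N) (gam0 : 0 <= gam).
Hypothesis gam_small : gam * (2 * S) ^+ (p + q) <= 1.
Local Notation RR := (measurableTypeR R).
Local Notation K := {ffun 'I_(p + q) -> 'I_M}.
Local Notation E := ((p.-tuple RR) * (q.-tuple RR))%type.
Implicit Types (th : {ffun K -> bool}) (c : K) (z : E).

Definition cell1 c : p.-tuple RR -> R := cell w (fun i => c (lshift q i)).
Definition cell2 c : q.-tuple RR -> R := cell w (fun j => c (rshift p j)).

Lemma tensor_cell_split c (t : (p + q).-tuple RR) :
  tensor (cell1 c) (cell2 c) (split_tuple t) = cell w c t.
Proof.
rewrite /tensor /cell1 /cell2 /cell big_split_ord /=.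
by congr (_ * _); apply: eq_bigr => i _; rewrite tnth_mktuple.
Qed.

(** Bounds and supports proved for cells in dimension [p + q] transfer to pairs
    of vectors through this surjectivity. *)
Lemma split_tuple_surj z : exists t : (p + q).-tuple RR, split_tuple t = z.
Proof.
case: z => x y; exists [tuple of x ++ y]; congr (_, _).
  by apply: eq_from_tnth => i; rewrite tnth_mktuple tnth_lshift.
by apply: eq_from_tnth => i; rewrite tnth_mktuple tnth_rshift.
Qed.

Lemma tensor_cell_le c z : `|tensor (cell1 c) (cell2 c) z| <= S ^+ (p + q).
Proof.
by have [t <-] := split_tuple_surj z; rewrite tensor_cell_split cell_le.
Qed.

Lemma tensor_cell_disjoint c c' z : c != c' ->
  tensor (cell1 c) (cell2 c) z * tensor (cell1 c') (cell2 c') z = 0.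
Proof.
have [t <-] := split_tuple_surj z; rewrite !tensor_cell_split.
exact: cell_disjoint.
Qed.

Definition base : E -> R := tensor (@cube R p) (@cube R q).

Lemma tensor_cell_support c z : tensor (cell1 c) (cell2 c) z != 0 ->
  base z = 2^-1 ^+ (p + q).
Proof.
rewrite /tensor mulf_eq0 negb_or => /andP[h1 h2].
rewrite /base /tensor (cube_unit (cell_support h1)).
by rewrite (cube_unit (cell_support h2)) -exprD.
Qed.

Definition noise th z : R :=
  gam * \sum_c sgn R th c * tensor (cell1 c) (cell2 c) z.

(** At most one cell is active at a given point. *)
Lemma noise_case th z : noise th z = 0 \/
  exists2 c, tensor (cell1 c) (cell2 c) z != 0 &
    noise th z = gam * (sgn R th c * tensor (cell1 c) (cell2 c) z).
Proof.
have [/existsP[c hc]|/existsPn h] :=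
  boolP [exists c, tensor (cell1 c) (cell2 c) z != 0]; [right|left].
  exists c => //; rewrite /noise (bigD1 c)//= big1 ?addr0// => c' cc'.
  have /eqP := tensor_cell_disjoint z cc'; rewrite mulf_eq0 (negbTE hc) orbF.
  by move=> /eqP ->; rewrite mulr0.
rewrite /noise big1 ?mulr0// => c _.
by have := h c; rewrite negbK => /eqP ->; rewrite mulr0.
Qed.

(** Where the noise lives, the base density is the constant [2 ^- (p + q)]; so
    this is the noise divided by the base density, without a division by 0. *)
Definition relative_noise th z : R := 2 ^+ (p + q) * noise th z.

Lemma noise_relative th z : noise th z = base z * relative_noise th z.
Proof.
rewrite /relative_noise; have [->|[c hc _]] := noise_case th z.
  by rewrite !mulr0.
by rewrite (tensor_cell_support hc) mulrA -exprMn mulVf// expr1n mul1r.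
Qed.

Lemma relative_noise_le th z : `|relative_noise th z| <= 1.
Proof.
rewrite /relative_noise normrM ger0_norm ?exprn_ge0//.
have [->|[c hc ->]] := noise_case th z; first by rewrite normr0 mulr0.
rewrite !normrM normr_sgn mul1r ger0_norm//; apply: le_trans gam_small.
rewrite mulrCA ler_wpM2l// exprMn ler_wpM2l ?exprn_ge0//.
by rewrite -normrM; exact: tensor_cell_le.
Qed.

Lemma base_ge0 z : 0 <= base z.
Proof. by rewrite mulr_ge0// cube_ge0. Qed.

Lemma base_le z : base z <= 2^-1 ^+ (p + q).
Proof. by rewrite exprD ler_pM ?cube_ge0// cube_le. Qed.

Lemma noise_le th z : `|noise th z| <= base z.
Proof.
rewrite noise_relative normrM ger0_norm ?base_ge0// ler_piMr ?base_ge0//.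
exact: relative_noise_le.
Qed.

Lemma noise_mul th th' z : noise th z * noise th' z =
  gam ^+ 2 * \sum_c sgn R th c * sgn R th' c * tensor (cell1 c) (cell2 c) z ^+
    2.
Proof.
rewrite /noise mulrACA -expr2; congr (_ * _).
rewrite big_distrlr /=; apply: eq_bigr => c _.
rewrite (bigD1 c)//= big1 ?addr0 => [|c' cc']; first by rewrite mulrACA -expr2.
by rewrite mulrACA tensor_cell_disjoint ?mulr0// eq_sym.
Qed.

Lemma measurable_tensor_cell c :
  measurable_fun setT (tensor (cell1 c) (cell2 c)).
Proof.
apply: measurable_funM.
  by apply: measurableT_comp; [exact: measurable_cell|exact: measurable_fst].
by apply: measurableT_comp; [exact: measurable_cell|exact: measurable_snd].
Qed.

Lemma measurable_noise th : measurable_fun setT (noise th).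
Proof.
apply: measurable_funM => //; apply: measurable_sum => c.
by apply: measurable_funM => //; exact: measurable_tensor_cell.
Qed.

(** Each cell function has integral zero in each block of variables: the noise
    is invisible in the marginals, as [p] and [q] are positive. *)
Lemma noise_section1 th x :
  (lebesgue R q).-integrable setT (fun y => (noise th (x, y))%:E) /\
  \int[lebesgue R q]_y noise th (x, y) = 0.
Proof.
have ic c : (lebesgue R q).-integrable setT
    (fun y => (gam * sgn R th c * cell1 c x * cell2 c y)%:E).
  under eq_fun do rewrite EFinM.
  by apply: integrableZl => //; exact: cell_integrable.
have E y : (noise th (x, y))%:E =
    (\sum_c (gam * sgn R th c * cell1 c x * cell2 c y)%:E)%E.
  rewrite sumEFin /noise big_distrr /=; congr EFin.
  by apply: eq_bigr => c _; rewrite /tensor /= !mulrA.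
split.
  by under eq_fun do rewrite E; apply: (integrable_sum measurableT) => c _;
    exact: ic.
rewrite /Rintegral; under eq_integral do rewrite E.
rewrite integral_sum//= big1// => c _.
under eq_integral do rewrite EFinM.
rewrite integralZl//; last exact: cell_integrable.
have i0 := cell_integral0 w (fun j => c (rshift p j)) q0.
have ci := cell_integrable w (fun j => c (rshift p j)).
rewrite -[X in (_ * X)%E]fineK; first by rewrite [fine _]i0 mule0.
exact: integrable_fin_num.
Qed.

Lemma noise_section2 th y :
  (lebesgue R p).-integrable setT (fun x => (noise th (x, y))%:E) /\
  \int[lebesgue R p]_x noise th (x, y) = 0.
Proof.
have ic c : (lebesgue R p).-integrable setT
    (fun x => (gam * sgn R th c * cell2 c y * cell1 c x)%:E).
  under eq_fun do rewrite EFinM.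
  by apply: integrableZl => //; exact: cell_integrable.
have E x : (noise th (x, y))%:E =
    (\sum_c (gam * sgn R th c * cell2 c y * cell1 c x)%:E)%E.
  rewrite sumEFin /noise big_distrr /=; congr EFin.
  by apply: eq_bigr => c _; rewrite /tensor /= !mulrA mulrAC.
split.
  by under eq_fun do rewrite E; apply: (integrable_sum measurableT) => c _;
    exact: ic.
rewrite /Rintegral; under eq_integral do rewrite E.
rewrite integral_sum//= big1// => c _.
under eq_integral do rewrite EFinM.
rewrite integralZl//; last exact: cell_integrable.
have i0 := cell_integral0 w (fun j => c (lshift q j)) p0.
have ci := cell_integrable w (fun j => c (lshift q j)).
rewrite -[X in (_ * X)%E]fineK; first by rewrite [fine _]i0 mule0.
exact: integrable_fin_num.
Qed.

Definition perturbed_fun th z : R := base z + noise th z.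

Lemma measurable_perturbed th : measurable_fun setT (perturbed_fun th).
Proof.
apply: measurable_funD; last exact: measurable_noise.
exact: (measurable_tensor (cube_density R p) (cube_density R q)).
Qed.

Lemma perturbed_ge0 th z : 0 <= perturbed_fun th z.
Proof.
by have := noise_le th z; rewrite ler_norml /perturbed_fun -lerBlDl sub0r =>
  /andP[].
Qed.

Lemma density_integrable dd (T : measurableType dd) (m : {measure set T -> \bar
  R})
  (f : density m) : m.-integrable setT (EFin \o f).
Proof.
apply/integrableP; split; first exact/measurable_EFinP/measurable_density.
under eq_integral do rewrite /= ger0_norm ?density_ge0//.
by rewrite integral_density ltry.
Qed.

Lemma perturbed_section1 th x : (\int[lebesgue R q]_y (perturbed_fun th (x,
  y))%:E =
  (cube x)%:E)%E.
Proof.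
have [i1 i0] := noise_section1 th x.
have ib : (lebesgue R q).-integrable setT (fun y => (base (x, y))%:E).
  under eq_fun do rewrite /base /tensor EFinM /=.
  by apply: integrableZl => //; exact: (density_integrable (cube_density R q)).
rewrite /perturbed_fun; under eq_integral do rewrite EFinD.
rewrite integralD_EFin//.
rewrite -[X in (_ + X)%E]fineK; last exact: integrable_fin_num.
rewrite [fine _]i0 adde0 /base /tensor /=.
under eq_integral do rewrite EFinM.
rewrite integralZl//; last exact: (density_integrable (cube_density R q)).
by rewrite (integral_density (cube_density R q)) mule1.
Qed.

Lemma perturbed_section2 th y : (\int[lebesgue R p]_x (perturbed_fun th (x,
  y))%:E =
  (cube y)%:E)%E.
Proof.
have [i1 i0] := noise_section2 th y.
have ib : (lebesgue R p).-integrable setT (fun x => (base (x, y))%:E).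
  under eq_fun do rewrite /base /tensor mulrC EFinM /=.
  by apply: integrableZl => //; exact: (density_integrable (cube_density R p)).
rewrite /perturbed_fun; under eq_integral do rewrite EFinD.
rewrite integralD_EFin//.
rewrite -[X in (_ + X)%E]fineK; last exact: integrable_fin_num.
rewrite [fine _]i0 adde0 /base /tensor /=.
under eq_integral do rewrite mulrC EFinM.
rewrite integralZl//; last exact: (density_integrable (cube_density R p)).
by rewrite (integral_density (cube_density R p)) mule1.
Qed.

Lemma integral_perturbed th :
  (\int[lebesgue2 R p q]_z (perturbed_fun th z)%:E = 1)%E.
Proof.
rewrite /lebesgue2 fubini_tonelli1//=; last 2 first.
- by apply/measurable_EFinP; exact: measurable_perturbed.
- by move=> z; rewrite lee_fin; exact: perturbed_ge0.
rewrite /fubini_F; under eq_integral do rewrite perturbed_section1.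
exact: integral_cube.
Qed.

Definition perturbed th : density (lebesgue2 R p q) :=
  Density (measurable_perturbed th) (perturbed_ge0 th) (integral_perturbed th).

Lemma marginal1_perturbed th : marginal1 (perturbed th) = @cube R p.
Proof. by apply/funext => x; rewrite /marginal1 /Rintegral perturbed_section1.
  Qed.

Lemma marginal2_perturbed th : marginal2 (perturbed th) = @cube R q.
Proof. by apply/funext => y; rewrite /marginal2 /Rintegral perturbed_section2.
  Qed.

(** The equality holds at every point, since the sections of the density are
    integrable everywhere. *)
Lemma dependence_perturbed th : dependence (perturbed th) = noise th.
Proof.
apply/funext => z; rewrite /dependence marginal1_perturbed marginal2_perturbed.
by rewrite /= /perturbed_fun addrAC subrr add0r.
Qed.

End perturbation.

Lemma ge0_integral_tensor d1 d2 (T1 : measurableType d1) (T2 : measurableType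
  d2)
    (R : realType) (m1 : {sigma_finite_measure set T1 -> \bar R})
    (m2 : {sigma_finite_measure set T2 -> \bar R}) (g : T1 -> R) (h : T2 -> R) :
  measurable_fun setT g -> measurable_fun setT h ->
  (forall x, 0 <= g x) -> (forall y, 0 <= h y) ->
  (\int[m1 \x m2]_z (tensor g h z)%:E =
   \int[m1]_x (g x)%:E * \int[m2]_y (h y)%:E)%E.
Proof.
move=> mg mh g0 h0.
have mgh : measurable_fun setT (tensor g h).
  apply: measurable_funM.
    by apply: measurableT_comp; [exact: mg|exact: measurable_fst].
  by apply: measurableT_comp; [exact: mh|exact: measurable_snd].
rewrite fubini_tonelli1//=; last 2 first.
- exact/measurable_EFinP.
- by move=> z; rewrite lee_fin mulr_ge0.
rewrite -ge0_integralZr//; last 3 first.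
- exact/measurable_EFinP.
- by move=> x _; rewrite lee_fin.
- by apply: integral_ge0 => y _; rewrite lee_fin.
apply: eq_integral => x _; rewrite /fubini_F /tensor /=.
under eq_integral do rewrite EFinM.
rewrite ge0_integralZl//; first exact/measurable_EFinP.
- by move=> y _; rewrite lee_fin.
- by rewrite lee_fin.
Qed.

Section smoothness_of_perturbation.
Variables (R : realType) (M : nat) (S l D : R) (k : nat).
Variable w : bump_system M S l D k.
Variables (p q : nat) (gam : R).
Hypotheses (M0 : (0 < M)%N) (l0 : 0 < l).
Local Notation mu := (@lebesgue_measure R).
Local Notation RR := (measurableTypeR R).
Local Notation K := {ffun 'I_(p + q) -> 'I_M}.
Local Notation X := ((p + q).-tuple RR).
Implicit Types (th : {ffun K -> bool}) (c : K) (u x : X).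

Lemma card_cells : #|K|%:R = M%:R ^+ (p + q) :> R.
Proof. by rewrite card_ffun !card_ord natrX. Qed.

Lemma tensor_cell_sqr c :
  (((l / M%:R) ^+ (p + q))%:E <=
   \int[lebesgue2 R p q]_z (tensor (cell1 w c) (cell2 w c) z ^+ 2)%:E <=
   ((S ^+ 2 / M%:R) ^+ (p + q))%:E)%E.
Proof.
have m1 := measurable_cell w (fun i => c (lshift q i)).
have m2 := measurable_cell w (fun i => c (rshift p i)).
rewrite [X in (_ <= X <= _)%E](_ : _ =
  \int[lebesgue R p]_t (cell1 w c t ^+ 2)%:E *
  \int[lebesgue R q]_y (cell2 w c y ^+ 2)%:E)%E; last first.
  rewrite -[RHS](ge0_integral_tensor (lebesgue R p) (lebesgue R q) (g := fun t
    => cell1 w c t ^+ 2)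
    (h := fun y => cell2 w c y ^+ 2)).
  - by apply: eq_integral => z _; rewrite /tensor exprMn.
  - exact: measurable_funX.
  - exact: measurable_funX.
  - by move=> t; exact: sqr_ge0.
  - by move=> t; exact: sqr_ge0.
have /andP[a1 b1] := cell_sqr w (fun i => c (lshift q i)) l0.
have /andP[a2 b2] := cell_sqr w (fun i => c (rshift p i)) l0.
have M1 : (0 : R) < M%:R by rewrite ltr0n.
rewrite !exprD !EFinM; apply/andP; split.
  by apply: lee_pmul => //; rewrite lee_fin exprn_ge0// divr_ge0// ltW.
by apply: lee_pmul => //; apply: integral_ge0 => t _; rewrite lee_fin sqr_ge0.
Qed.

(** The cells are disjoint, so their energies add up: [M ^ (p + q)] cells of
    energy at least [(l / M) ^ (p + q)] each. *)
Lemma noise_sqr_ge th :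
  ((gam ^+ 2 * l ^+ (p + q))%:E <=
   \int[lebesgue2 R p q]_z (noise w gam th z ^+ 2)%:E)%E.
Proof.
have E z : (noise w gam th z ^+ 2)%:E =
    ((gam ^+ 2)%:E * \sum_c (tensor (cell1 w c) (cell2 w c) z ^+ 2)%:E)%E.
  rewrite expr2 noise_mul sumEFin -EFinM; congr (_ * _)%:E.
  by apply: eq_bigr => c _; rewrite sgn_sqr mul1r.
have mt c : measurable_fun setT
    (fun z => (tensor (cell1 w c) (cell2 w c) z ^+ 2)%:E).
  apply/measurable_EFinP; apply: measurable_funX; exact: measurable_tensor_cell.
under eq_integral do rewrite E.
rewrite ge0_integralZl//; last 3 first.
- by apply: emeasurable_sum => c _; exact: mt.
- by move=> z _; apply: sume_ge0 => c _; rewrite lee_fin sqr_ge0.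
- by rewrite lee_fin sqr_ge0.
rewrite EFinM; apply: lee_wpmul2l; first by rewrite lee_fin sqr_ge0.
rewrite ge0_integral_sum//; last by move=> c z _; rewrite lee_fin sqr_ge0.
apply: (@le_trans _ _ (\sum_(c : K) ((l / M%:R) ^+ (p + q))%:E)%E).
  rewrite sumEFin sumr_const -[_ *+ #|_|]mulr_natr card_cells lee_fin
    expr_div_n.
  by rewrite mulfVK// expf_neq0// pnatr_eq0 -lt0n.
by apply: lee_sum => c _; have /andP[] := tensor_cell_sqr c.
Qed.

Lemma noise_split th x : (noise w gam th \o @split_tuple R p q) x =
  gam * \sum_(c : K) sgn R th c * cell w c x.
Proof.
by rewrite /noise /=; congr (_ * _); apply: eq_bigr => c _; rewrite
  tensor_cell_split.
Qed.

Lemma measurable_split_tuple : measurable_fun setT (@split_tuple R p q).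
Proof.
apply/measurable_fun_pairP; split.
  apply/measurable_fun_tnthP => i.
  rewrite (_ : _ \o _ = fun z : X => tnth z (lshift q i)).
    exact: measurable_tnth.
  by apply/funext => z /=; rewrite tnth_mktuple.
apply/measurable_fun_tnthP => i.
rewrite (_ : _ \o _ = fun z : X => tnth z (rshift p i)).
  exact: measurable_tnth.
by apply/funext => z /=; rewrite tnth_mktuple.
Qed.

Lemma noise_Lfun1 th :
  noise w gam th \o @split_tuple R p q \in Lfun (lebesgue R (p + q)) 1%E.
Proof.
apply/Lfun1_integrable.
rewrite (_ : _ \o _ = fun x => (gam%:E * \sum_(c : K) (sgn R th c)%:E * (cell w
  c x)%:E)%E).
  apply: integrableZl => //; apply: (integrable_sum measurableT) => c _.
  by apply: integrableZl => //; exact: cell_integrable.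
apply/funext => x /=; have /= -> := noise_split th x; rewrite EFinM -sumEFin.
by congr (_ * _)%E; apply: eq_bigr => c _; rewrite EFinM.
Qed.

Lemma noise_Lfun2 th :
  noise w gam th \o @split_tuple R p q \in Lfun (lebesgue R (p + q)) 2%:E.
Proof.
apply: Lfun2_sqr.
  by apply: measurableT_comp; [exact: measurable_noise|exact:
    measurable_split_tuple].
have mc c : measurable_fun setT (fun x => (cell w c x ^+ 2)%:E).
  by apply/measurable_EFinP; apply: measurable_funX; exact: measurable_cell.
rewrite (_ : (\int[_]_x _)%E = (\int[lebesgue R (p + q)]_x
    ((gam ^+ 2)%:E * \sum_(c : K) (cell w c x ^+ 2)%:E))%E); last first.
  apply: eq_integral => x _; rewrite /= expr2 noise_mul sumEFin -EFinM.
  congr (_ * _)%:E; apply: eq_bigr => c _.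
  by rewrite sgn_sqr mul1r tensor_cell_split.
rewrite ge0_integralZl//; last 3 first.
- by apply: emeasurable_sum => c _; exact: mc.
- by move=> z _; apply: sume_ge0 => c _; rewrite lee_fin sqr_ge0.
- by rewrite lee_fin sqr_ge0.
rewrite ge0_integral_sum//; last by move=> c z _; rewrite lee_fin sqr_ge0.
apply: lte_mul_pinfty; rewrite ?lee_fin ?sqr_ge0//.
apply: lte_sum_pinfty => c _; have /andP[_ h] := cell_sqr w c l0.
by apply: le_lt_trans h _; rewrite ltry.
Qed.

End smoothness_of_perturbation.

(** * Sobolev energy of the perturbation *)

Section spectral_energy.
Variables (R : realType) (M : nat) (S l D : R) (k : nat).
Variable w : bump_system M S l D k.
Variables (p q : nat) (gam delta : R).
Hypotheses (M0 : (0 < M)%N) (delta0 : 0 < delta).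
(* The decay (1 + v^2)^(- 2 k) of the squared transform of a bump must absorb
   the Sobolev weight (1 + v^2)^delta and leave (1 + v^2)^(- 1), which is
   integrable. *)
Hypothesis k_large : 1 + delta <= (2 * k)%:R.
Local Notation mu := (@lebesgue_measure R).
Local Notation RR := (measurableTypeR R).
Local Notation d := (p + q)%N.
Local Notation K := {ffun 'I_(p + q) -> 'I_M}.
Local Notation X := ((p + q).-tuple RR).
Implicit Types (th : {ffun K -> bool}) (c : K) (u x : X).

Definition cell_transform c b u : R :=
  cos_transform (fun i => w (c i)) (tnth u) b.

Definition energy th : \bar R :=
  (\int[lebesgue R d]_u (enorm u `^ (2 * delta) *
    Normc.normc (fourier (noise w gam th \o @split_tuple R p q) u) ^+ 2)%:E)%E.

Lemma noise_cos_transform th u b :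
  \int[lebesgue R d]_x ((noise w gam th \o @split_tuple R p q) x *
    cos (dotp x u + b)) =
  gam * \sum_(c : K) sgn R th c * cell_transform c b u.
Proof.
have ic c := integrable_cos_transform (tnth u) b
  (fun i => bump_fun_integrable w (c i)).
have ic' c : (lebesgue R d).-integrable setT
    (fun x => ((gam * sgn R th c) * (cell w c x * cos (dotp x u + b)))%:E).
  by under eq_fun do rewrite EFinM; apply: integrableZl => //; exact: ic.
transitivity (\int[lebesgue R d]_x
    \sum_(c : K) (gam * sgn R th c) * (cell w c x * cos (dotp x u + b))).
  apply: eq_Rintegral => x _; rewrite noise_split big_distrr big_distrl /=.
  by apply: eq_bigr => c _; rewrite !mulrA.
rewrite /Rintegral; under eq_integral do rewrite -sumEFin.
rewrite integral_sum//= big_distrr /=.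
rewrite (_ : (\sum_c _)%E = (\sum_(c : K) (gam * (sgn R th c * cell_transform c
  b u))%:E)%E).
  by rewrite sumEFin.
apply: eq_bigr => c _; under eq_integral do rewrite EFinM.
rewrite integralZl//; last exact: ic.
rewrite -[X in (_ * X)%E]fineK; last by apply: integrable_fin_num => //; exact:
  ic.
by rewrite -EFinM mulrA.
Qed.

Lemma noise_fourier_sqr th u :
  Normc.normc (fourier (noise w gam th \o @split_tuple R p q) u) ^+ 2 =
  gam ^+ 2 * ((\sum_(c : K) sgn R th c * cell_transform c 0 u) ^+ 2 +
    (\sum_(c : K) sgn R th c * cell_transform c (- (pi / 2)) u) ^+ 2).
Proof.
rewrite /fourier /Normc.normc sqr_sqrtr ?addr_ge0 ?sqr_ge0//.
rewrite (_ : \int[_]_x _ = \int[lebesgue R d]_x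
    ((noise w gam th \o @split_tuple R p q) x * cos (dotp x u + 0))); last
      first.
  by apply: eq_Rintegral => x _; rewrite addr0.
rewrite (_ : \int[_]_x (_ * sin _) = \int[lebesgue R d]_x
    ((noise w gam th \o @split_tuple R p q) x * cos (dotp x u - pi / 2))); last
      first.
  by apply: eq_Rintegral => x _; rewrite -[X in sin X](subrK (pi / 2))
    sinDpihalf.
by rewrite !noise_cos_transform !exprMn mulrDr.
Qed.

Lemma sum_fourier_sqr u :
  \sum_th Normc.normc (fourier (noise w gam th \o @split_tuple R p q) u) ^+ 2 =
  #|{ffun K -> bool}|%:R * (gam ^+ 2 * \sum_(c : K)
    (cell_transform c 0 u ^+ 2 + cell_transform c (- (pi / 2)) u ^+ 2)).
Proof.
under eq_bigr do rewrite noise_fourier_sqr.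
rewrite -big_distrr /= big_split /= !sum_sgn_sqr -mulrDr -big_split /=.
by rewrite mulrCA.
Qed.

(** The Cauchy kernel at scale [M], times its constant. *)
Definition profile (i : 'I_d) (v : R) : R :=
  2 * D ^+ 2 / M%:R * (M%:R^-1 * (1 + (v / M%:R) ^+ 2)^-1).

Let M1 : (0 : R) < M%:R. Proof. by rewrite ltr0n. Qed.

Let weight_ge1 (v : R) : 1 <= 1 + (v / M%:R) ^+ 2.
Proof. by rewrite lerDl sqr_ge0. Qed.

Lemma profile_ge0 i v : 0 <= profile i v.
Proof.
have h : 0 <= 1 + (v / M%:R) ^+ 2 by apply: le_trans (weight_ge1 v).
apply: mulr_ge0; last by rewrite mulr_ge0// invr_ge0.
by rewrite divr_ge0// mulr_ge0// sqr_ge0.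
Qed.

(** In the rescaled frequency [v = u / M], the sum of the [v_i ^ 2] is at most
    the product of the [1 + v_i ^ 2]. The Sobolev weight, which is not a
    product, is thus bounded by one that is, at the right power of [M]. *)
Lemma enorm_powR_le u :
  enorm u `^ (2 * delta) <= M%:R `^ (2 * delta) *
    \prod_(i < d) (1 + ((tnth u i : R) / M%:R) ^+ 2) `^ delta.
Proof.
have b1 i := weight_ge1 (tnth u i).
have b0 i := le_trans ler01 (b1 i).
have dot0 : 0 <= dotp u u by apply: sumr_ge0 => i _; exact: sqr_ge0.
have -> : enorm u `^ (2 * delta) = dotp u u `^ delta.
  by rewrite /enorm -powR12_sqrt// -powRrM mulrA mulVf// mul1r.
have -> : \prod_(i < d) (1 + ((tnth u i : R) / M%:R) ^+ 2) `^ delta =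
    (\prod_(i < d) (1 + ((tnth u i : R) / M%:R) ^+ 2)) `^ delta.
  suff [] : \prod_(i < d) (1 + ((tnth u i : R) / M%:R) ^+ 2) `^ delta =
    (\prod_(i < d) (1 + ((tnth u i : R) / M%:R) ^+ 2)) `^ delta /\
    0 <= \prod_(i < d) (1 + ((tnth u i : R) / M%:R) ^+ 2) by [].
  apply: (big_ind2 (fun a b : R => a = b `^ delta /\ 0 <= b)) => //.
  - by rewrite powR1.
  - move=> a a' b b' [-> a'0] [-> b'0].
    by rewrite powRM// mulr_ge0.
have pb0 : 0 <= \prod_(i < d) (1 + ((tnth u i : R) / M%:R) ^+ 2).
  exact: prodr_ge0.
rewrite powRrM powR_mulrn ?ler0n// -powRM ?exprn_ge0//.
apply: ge0_ler_powR; rewrite ?nnegrE ?(ltW delta0)// ?mulr_ge0 ?exprn_ge0//.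
have -> : dotp u u = M%:R ^+ 2 * \sum_(i < d) ((tnth u i : R) / M%:R) ^+ 2.
  rewrite big_distrr /=; apply: eq_bigr => i _; rewrite -exprMn [M%:R * _]mulrC.
  by rewrite mulfVK ?gt_eqF// expr2.
rewrite ler_wpM2l ?exprn_ge0//.
suff [h _] : 1 + \sum_(i < d) ((tnth u i : R) / M%:R) ^+ 2 <=
    \prod_(i < d) (1 + ((tnth u i : R) / M%:R) ^+ 2) /\
    0 <= \sum_(i < d) ((tnth u i : R) / M%:R) ^+ 2.
  by apply: le_trans h; rewrite lerDr.
apply: (big_ind2 (fun a b : R => 1 + a <= b /\ 0 <= a)).
- by rewrite addr0.
- move=> a a' b b' [h a0] [h' b0']; split; last exact: addr_ge0.
  have : (1 + a) * (1 + b) <= a' * b' by apply: ler_pM => //; exact: addr_ge0.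
  by apply: le_trans; have := mulr_ge0 a0 b0'; lra.
- by move=> i _; rewrite lexx sqr_ge0.
Qed.

Lemma cell_transform_le c u :
  cell_transform c 0 u ^+ 2 + cell_transform c (- (pi / 2)) u ^+ 2 <=
  \prod_(i < d) (2 * (D / M%:R / (1 + ((tnth u i : R) / M%:R) ^+ 2) ^+ k) ^+ 2).
Proof.
rewrite cos_transform_sqr => [|i]; last exact: bump_fun_integrable.
apply: ler_prod => i _; rewrite addr_ge0 ?sqr_ge0//= mulr_natl mulr2n.
have h b := bump_fun_fourier w (c i) (tnth u i) b.
have := h 0; under eq_Rintegral do rewrite addr0.
move=> h0; apply: lerD; rewrite -[leLHS]real_normK ?num_real//.
  by rewrite lerXn2r// nnegrE// (le_trans _ h0).
by rewrite lerXn2r// ?nnegrE ?(le_trans _ (h (- (pi / 2)))).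
Qed.

Lemma weighted_transform_le c u :
  enorm u `^ (2 * delta) *
    (cell_transform c 0 u ^+ 2 + cell_transform c (- (pi / 2)) u ^+ 2) <=
  M%:R `^ (2 * delta) * \prod_(i < d) profile i (tnth u i).
Proof.
apply: (@le_trans _ _ (M%:R `^ (2 * delta) *
    \prod_(i < d) (1 + ((tnth u i : R) / M%:R) ^+ 2) `^ delta *
    \prod_(i < d) (2 * (D / M%:R / (1 + ((tnth u i : R) / M%:R) ^+ 2) ^+ k) ^+
      2))).
  apply: ler_pM; rewrite ?powR_ge0 ?addr_ge0 ?sqr_ge0//.
    exact: enorm_powR_le.
  exact: cell_transform_le.
rewrite -mulrA ler_wpM2l ?powR_ge0// -big_split /=.
apply: ler_prod => i _; apply/andP; split.
  by apply: mulr_ge0; [exact: powR_ge0|apply: mulr_ge0 => //; exact: sqr_ge0].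
have b1 := weight_ge1 (tnth u i); rewrite /profile.
move: (1 + (_ / _) ^+ 2) b1 => b b1.
have b0 : 0 < b by exact: lt_le_trans b1.
have -> : b `^ delta * (2 * (D / M%:R / b ^+ k) ^+ 2) =
    2 * D ^+ 2 / M%:R / M%:R * (b `^ delta / b ^+ (2 * k)).
  rewrite mulnC exprM; field.
  by rewrite expf_neq0 ?gt_eqF.
rewrite [leRHS]mulrA; apply: ler_wpM2l.
  by rewrite !divr_ge0// mulr_ge0// sqr_ge0.
rewrite ler_pdivrMr ?exprn_gt0// mulrC ler_pdivlMr//.
have -> : b `^ delta * b = b `^ (1 + delta).
  rewrite powRD; last by rewrite (gt_eqF b0) implybT.
  by rewrite powRr1 ?ltW// mulrC.
by rewrite -(powR_mulrn _ (ltW b0)) ler_powR.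
Qed.

Lemma measurable_weight :
  measurable_fun setT (fun v : R => M%:R^-1 * (1 + (v / M%:R) ^+ 2)^-1).
Proof.
apply: measurable_funM => //.
apply: (measurableT_comp (f := fun v : R => (oneDsqr v)^-1)
  (g := fun v : R => v / M%:R)); last exact: measurable_funM.
by apply: continuous_measurable_fun => v; exact: continuous_oneDsqrV.
Qed.

Lemma measurable_profile i : measurable_fun setT (profile i).
Proof. by apply: measurable_funM => //; exact: measurable_weight. Qed.

Lemma integral_profile :
  (\int[lebesgue R d]_u (\prod_(i < d) profile i (tnth u i))%:E =
   ((2 * D ^+ 2 / M%:R * pi) ^+ d)%:E)%E.
Proof.
rewrite [LHS](ge0_integral_iter_product_prod mu); last 2 first.
- exact: measurable_profile.
- exact: profile_ge0.
rewrite -[d in RHS]card_ord -prodr_const -prodEFin; apply: eq_bigr => i _.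
rewrite EFinM -(integral_cauchy_kernel M1) -ge0_integralZl//.
- by apply/measurable_EFinP; exact: measurable_weight.
- by move=> v _; rewrite lee_fin mulr_ge0 ?invr_ge0// (le_trans ler01).
- by rewrite lee_fin divr_ge0// mulr_ge0// sqr_ge0.
Qed.

Lemma measurable_cell_transform c b : measurable_fun setT (cell_transform c b).
Proof.
apply: (measurable_fun_Rintegral (lebesgue R d) (f := fun z : X * X =>
  cell w c z.2 * cos (phase (tnth z.1) z.2 + b))).
apply: measurable_funM.
  by apply: measurableT_comp; [exact: measurable_cell|exact: measurable_snd].
apply: measurableT_comp.
  by apply: continuous_measurable_fun; exact: continuous_cos.
apply: measurable_funD => //; apply: measurable_sum => i.
apply: measurable_funM.
  by apply: (measurableT_comp (measurable_tnth i)); exact: measurable_snd.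
by apply: (measurableT_comp (measurable_tnth i)); exact: measurable_fst.
Qed.

Lemma measurable_enorm_powR : measurable_fun setT (fun u => enorm u `^ (2 *
  delta)).
Proof.
apply: (measurableT_comp (measurable_powR _)).
apply: measurableT_comp.
  by apply: continuous_measurable_fun; exact: sqrt_continuous.
by apply: measurable_sum => i; apply: measurable_funM; exact: measurable_tnth.
Qed.

(** The average over the signs has no cross terms, and all the cells share the
    same bound: the average Sobolev energy is [(gam M ^ delta) ^ 2] up to a
    constant. *)
Lemma sum_energy : (\sum_th energy th <=
  (#|{ffun K -> bool}|%:R * ((gam * M%:R `^ delta) ^+ 2 *
    (2 * pi * D ^+ 2) ^+ d))%:E)%E.
Proof.
have mtr c b := measurable_cell_transform c b.
have me th : measurable_fun setT (fun u => (enorm u `^ (2 * delta) *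
    Normc.normc (fourier (noise w gam th \o @split_tuple R p q) u) ^+ 2)%:E).
  apply/measurable_EFinP; apply: measurable_funM; first exact:
    measurable_enorm_powR.
  rewrite (_ : (fun u => _) = fun u => gam ^+ 2 *
    ((\sum_(c : K) sgn R th c * cell_transform c 0 u) ^+ 2 +
    (\sum_(c : K) sgn R th c * cell_transform c (- (pi / 2)) u) ^+ 2)).
    apply: measurable_funM => //; apply: measurable_funD; apply:
      measurable_funX;
      by apply: measurable_sum => c; apply: measurable_funM.
  by apply/funext => u; exact: noise_fourier_sqr.
rewrite /energy -ge0_integral_sum//; last first.
  by move=> th u _; rewrite lee_fin mulr_ge0 ?powR_ge0 ?sqr_ge0.
apply: (@le_trans _ _ (\int[lebesgue R d]_u
  ((#|{ffun K -> bool}|%:R * (gam ^+ 2 * (M%:R ^+ d * M%:R `^ (2 * delta))))%:E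
    *
   (\prod_(i < d) profile i (tnth u i))%:E))%E).
  apply: ge0_le_integral => //.
  - move=> u _; apply: sume_ge0 => th _.
    by rewrite lee_fin mulr_ge0 ?powR_ge0 ?sqr_ge0.
  - by apply: emeasurable_sum => th _; exact: me.
  - apply: emeasurable_funM => //; apply/measurable_EFinP.
    by apply: (measurable_prod_tnth (G := profile)); exact: measurable_profile.
  move=> u _; rewrite sumEFin -EFinM lee_fin -big_distrr /= sum_fourier_sqr.
  rewrite mulrCA -[leRHS]mulrA ler_wpM2l ?ler0n// mulrCA -[leRHS]mulrA.
  rewrite ler_wpM2l ?sqr_ge0// big_distrr /=.
  apply: (@le_trans _ _ (\sum_(c : K) M%:R `^ (2 * delta) *
      \prod_(i < d) profile i (tnth u i))).
    by apply: ler_sum => c _; exact: weighted_transform_le.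
  by rewrite sumr_const -[_ *+ #|_|]mulr_natl card_cells mulrA.
rewrite ge0_integralZl//; last 3 first.
- apply/measurable_EFinP.
  by apply: (measurable_prod_tnth (G := profile)); exact: measurable_profile.
- by move=> u _; rewrite lee_fin prodr_ge0// => i _; exact: profile_ge0.
- by rewrite lee_fin mulr_ge0// mulr_ge0 ?sqr_ge0// mulr_ge0 ?powR_ge0//
  exprn_ge0.
rewrite integral_profile -EFinM lee_fin.
rewrite le_eqVlt; apply/orP; left; apply/eqP.
have -> : M%:R `^ (2 * delta) = (M%:R `^ delta : R) ^+ 2.
  by rewrite [2 * delta]mulrC powRrM powR_mulrn// powR_ge0.
have -> : 2 * D ^+ 2 / M%:R * pi = 2 * pi * D ^+ 2 / M%:R by rewrite mulrAC;
  ring.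
rewrite expr_div_n.
have simpl_M (a g m b x : R) : m != 0 ->
    a * (g ^+ 2 * (m * b ^+ 2)) * (x / m) = a * ((g * b) ^+ 2 * x).
  by move=> m0; field.
by rewrite simpl_M// expf_neq0 ?gt_eqF.
Qed.

End spectral_energy.

(** * Second moments of likelihood ratios *)

Section second_moment.
Context dd (T : measurableType dd) (R : realType) (m : {measure set T -> \bar
  R}).
Variables (I : finType) (L : I -> T -> R).
Hypotheses (mT : m setT = 1%E) (i0 : I).
Hypothesis mL : forall i, measurable_fun setT (L i).
Hypothesis L0 : forall i t, 0 <= L i t.
Hypothesis L1 : forall i, (\int[m]_t (L i t)%:E = 1)%E.

(** Le Cam's method. If [Lb] is the average of the [L i], then
    [\1_A Lb <= \1_A + (Lb - 1) ^ 2 / (2 e) + e / 2] at every point, and the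
    integral of [(Lb - 1) ^ 2] is the second moment of [Lb] minus 1. The weighted
    arithmetic-geometric inequality replaces that of Cauchy and Schwarz, so
    that only nonnegative functions are integrated. *)
Lemma second_moment_bound (A : set T) (a Q e : R) : measurable A -> 0 < e ->
  (m A <= a%:E)%E ->
  (\sum_i \sum_j \int[m]_t (L i t * L j t)%:E <= (#|I|%:R ^+ 2 * (1 + Q))%:E)%E
    ->
  (\sum_i \int[m]_t (\1_A t * L i t)%:E <= (#|I|%:R * (a + Q / (2 * e) + e /
    2))%:E)%E.
Proof.
move=> mA e0 Aa hQ; set N : R := #|I|%:R in hQ *.
have N0 : 0 < N by rewrite ltr0n; apply/card_gt0P; exists i0.
have m1A : measurable_fun setT (\1_A : T -> R) by exact: measurable_indic.
have m1 i : measurable_fun setT (fun t => (\1_A t * L i t)%:E).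
  by apply/measurable_EFinP; apply: measurable_funM.
have m2 i : measurable_fun setT (fun t => (L i t)%:E) by exact/measurable_EFinP.
have m3 i j : measurable_fun setT (fun t => (L i t * L j t)%:E).
  by apply/measurable_EFinP; apply: measurable_funM.
have p1 i t : (0 <= (\1_A t * L i t)%:E)%E by rewrite lee_fin mulr_ge0.
have p3 i j t : (0 <= (L i t * L j t)%:E)%E by rewrite lee_fin mulr_ge0.
have pt t : (\sum_i (\1_A t * L i t)%:E + (e^-1)%:E * \sum_i (L i t)%:E <=
    N%:E * (\1_A t)%:E + ((2 * e * N)^-1%:E * \sum_i \sum_j (L i t * L j t)%:E +
      (N * ((2 * e)^-1 + e / 2))%:E))%E.
  under [X in (_ <= _ + (_ * X + _))%E]eq_bigr do rewrite sumEFin.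
  rewrite !sumEFin -!EFinM -!EFinD lee_fin -big_distrr -big_distrlr /=.
  set x := \sum_i L i t; pose y := x / N; have -> : x = N * y.
    by rewrite /y mulrC mulfVK// gt_eqF.
  have -> : (2 * e * N)^-1 * (N * y * (N * y)) = N * (y ^+ 2 / (2 * e)).
    by field; rewrite !gt_eqF.
  rewrite [\1_A t * _]mulrCA [e^-1 * _]mulrCA -!mulrDr ler_pM2l//.
  have h : 0 <= (y - 1) ^+ 2 / (2 * e) - (y - 1) + e / 2.
    have -> : (y - 1) ^+ 2 / (2 * e) - (y - 1) + e / 2 = (y - 1 - e) ^+ 2 / (2
      * e).
      by field; rewrite gt_eqF.
    by rewrite divr_ge0 ?sqr_ge0// mulr_ge0// ltW.
  have h' : 0 <= (y - 1) ^+ 2 / (2 * e) + e / 2.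
    by rewrite addr_ge0 ?divr_ge0 ?sqr_ge0 ?mulr_ge0// ltW.
  have E : y ^+ 2 / (2 * e) + ((2 * e)^-1 + e / 2) - e^-1 * y =
      (y - 1) ^+ 2 / (2 * e) + e / 2 by field; rewrite gt_eqF.
  by rewrite indicE; case: (t \in A) => /=; rewrite ?mul1r ?mul0r; lra.
have ci : (\int[m]_t (\sum_i (\1_A t * L i t)%:E + (e^-1)%:E * \sum_i (L i
  t)%:E) =
    \sum_i \int[m]_t (\1_A t * L i t)%:E + (e^-1)%:E * N%:E)%E.
  rewrite ge0_integralD//; first last.
  - by apply: emeasurable_funM => //; apply: emeasurable_sum.
  - by move=> t _; rewrite mule_ge0 ?lee_fin ?invr_ge0 ?(ltW e0)// sume_ge0//
    => i _; rewrite lee_fin.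
  - by apply: emeasurable_sum.
  - by move=> t _; rewrite sume_ge0// => i _; exact: p1.
  rewrite ge0_integral_sum// ge0_integralZl//; first last.
  - by rewrite lee_fin invr_ge0 ltW.
  - by move=> t _; rewrite sume_ge0// => i _; rewrite lee_fin.
  - by apply: emeasurable_sum.
  congr (_ + _ * _)%E; rewrite ge0_integral_sum//; last by move=> i t _;
    rewrite lee_fin.
  under eq_bigr do rewrite L1.
  by rewrite sumEFin sumr_const.
have ci' : (\int[m]_t (N%:E * (\1_A t)%:E +
      ((2 * e * N)^-1%:E * \sum_i \sum_j (L i t * L j t)%:E +
      (N * ((2 * e)^-1 + e / 2))%:E)) =
    N%:E * m A + ((2 * e * N)^-1%:E * (\sum_i \sum_j \int[m]_t (L i t * L j
      t)%:E) +
      (N * ((2 * e)^-1 + e / 2))%:E))%E.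
  have m33 : measurable_fun setT (fun t => \sum_i \sum_j (L i t * L j t)%:E)%E.
    by apply: emeasurable_sum => i; apply: emeasurable_sum => j; exact: m3.
  have p33 t : (0 <= \sum_i \sum_j (L i t * L j t)%:E)%E.
    by apply: sume_ge0 => i _; apply: sume_ge0 => j _; exact: p3.
  have c0 : (0 <= (2 * e * N)^-1%:E)%E.
    by rewrite lee_fin invr_ge0 !mulr_ge0 ?(ltW e0) ?(ltW N0).
  have c1 : (0 <= (N * ((2 * e)^-1 + e / 2))%:E)%E.
    by rewrite lee_fin mulr_ge0 ?(ltW N0)// addr_ge0 ?invr_ge0 ?divr_ge0
      ?mulr_ge0 ?(ltW e0).
  have mi : measurable_fun setT (fun t => (\1_A t : R)%:E) by
    exact/measurable_EFinP.
  rewrite ge0_integralD//; first last.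
  - by apply: emeasurable_funD => //; apply: emeasurable_funM.
  - by move=> t _; rewrite adde_ge0// mule_ge0.
  - by apply: emeasurable_funM.
  - by move=> t _; rewrite mule_ge0// lee_fin// ltW.
  rewrite ge0_integralZl//; last by rewrite lee_fin ltW.
  rewrite integral_indic// setIT ge0_integralD//; first last.
  - by apply: emeasurable_funM.
  - by move=> t _; rewrite mule_ge0.
  rewrite ge0_integralZl// integral_cst// mT mule1.
  congr (_ + (_ * _ + _))%E; rewrite ge0_integral_sum//; first last.
  - by move=> i t _; apply: sume_ge0 => j _; exact: p3.
  - by move=> i; apply: emeasurable_sum.
  by apply: eq_bigr => i _; rewrite ge0_integral_sum.
have le : (\sum_i \int[m]_t (\1_A t * L i t)%:E + (e^-1)%:E * N%:E <=
    (N * a + (N * (1 + Q) / (2 * e) + N * ((2 * e)^-1 + e / 2)))%:E)%E.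
  rewrite -ci.
  have h : (N%:E * m A + ((2 * e * N)^-1%:E *
      (\sum_i \sum_j \int[m]_t (L i t * L j t)%:E) +
      (N * ((2 * e)^-1 + e / 2))%:E) <=
    (N * a + (N * (1 + Q) / (2 * e) + N * ((2 * e)^-1 + e / 2)))%:E)%E.
    rewrite !EFinD; apply: leeD.
      by rewrite EFinM; apply: lee_wpmul2l => //; rewrite lee_fin ltW.
    apply: leeD => //.
    have -> : (N * (1 + Q) / (2 * e))%:E =
        ((2 * e * N)^-1%:E * (N ^+ 2 * (1 + Q))%:E)%E.
      by rewrite -EFinM; congr EFin; field; rewrite !gt_eqF.
    apply: lee_wpmul2l => //.
    by rewrite lee_fin invr_ge0 !mulr_ge0 ?(ltW e0) ?(ltW N0).
  apply: le_trans h; rewrite -ci'; apply: ge0_le_integral => //.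
  - move=> t _; rewrite adde_ge0// ?mule_ge0 ?lee_fin ?invr_ge0 ?(ltW e0)//.
      by apply: sume_ge0 => i _; exact: p1.
    by apply: sume_ge0 => i _; rewrite lee_fin.
  - apply: emeasurable_funD; first by apply: emeasurable_sum.
    by apply: emeasurable_funM => //; apply: emeasurable_sum.
  - apply: emeasurable_funD; first by apply: emeasurable_funM => //;
    exact/measurable_EFinP.
    apply: emeasurable_funD => //; apply: emeasurable_funM => //.
    by apply: emeasurable_sum => i; apply: emeasurable_sum => j; exact: m3.
rewrite -EFinM -leeBrDr// -EFinB in le.
apply: le_trans le _; rewrite lee_fin le_eqVlt; apply/orP; left; apply/eqP.
by field; rewrite gt_eqF.
Qed.

End second_moment.

Section likelihood.
Variables (R : realType) (M : nat) (S l D : R) (k : nat).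
Variable w : bump_system M S l D k.
Variables (p q : nat) (gam : R).
Hypotheses (M0 : (0 < M)%N) (q0 : (0 < q)%N).
Hypotheses (l0 : 0 < l) (gam0 : 0 <= gam).
Hypothesis gam_small : gam * (2 * S) ^+ (p + q) <= 1.
Local Notation RR := (measurableTypeR R).
Local Notation d := (p + q)%N.
Local Notation K := {ffun 'I_(p + q) -> 'I_M}.
Local Notation E := ((p.-tuple RR) * (q.-tuple RR))%type.
Local Notation mu := (lebesgue2 R p q).
Implicit Types (th : {ffun K -> bool}) (c : K) (z : E).

Definition pert th : density mu := perturbed w q0 gam0 gam_small th.

Definition base_density : density mu :=
  tensor_density (cube_density R p) (cube_density R q).

Definition ratio th z : R := 1 + relative_noise w gam th z.

Lemma ratio_ge0 th z : 0 <= ratio th z.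
Proof.
have := relative_noise_le w gam0 gam_small th z.
by rewrite ler_norml /ratio -lerBlDl sub0r => /andP[].
Qed.

Lemma measurable_ratio th : measurable_fun setT (ratio th).
Proof.
apply: measurable_funD => //; apply: measurable_funM => //.
exact: measurable_noise.
Qed.

Lemma pert_ratio th z : pert th z = base_density z * ratio th z.
Proof. by rewrite /= /perturbed_fun /ratio mulrDr mulr1 -noise_relative. Qed.

Lemma integral_pert th (G : E -> \bar R) :
  measurable_fun setT G -> (forall z, 0 <= G z)%E ->
  (\int[density_prob (pert th)]_z G z =
   \int[density_prob base_density]_z (G z * (ratio th z)%:E))%E.
Proof.
move=> mG G0; rewrite !ge0_integral_density_prob//; first last.
- by move=> z; rewrite mule_ge0// lee_fin ratio_ge0.
- by apply: emeasurable_funM => //; apply/measurable_EFinP; exact: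
  measurable_ratio.
by apply: eq_integral => z _; rewrite pert_ratio mulrC EFinM muleA.
Qed.

Definition likelihood (n : nat) th (t : n.-tuple E) : R :=
  \prod_(i < n) ratio th (tnth t i).

Lemma measurable_likelihood n th : measurable_fun setT (@likelihood n th).
Proof.
by apply: (measurable_prod_tnth (G := fun=> ratio th)) => i; exact:
  measurable_ratio.
Qed.

Lemma likelihood_ge0 n th (t : n.-tuple E) : 0 <= likelihood th t.
Proof. by apply: prodr_ge0 => i _; exact: ratio_ge0. Qed.

Lemma iid_law_likelihood n th (A : set (n.-tuple E)) : measurable A ->
  iid_law n (pert th) A =
  (\int[iid_law n base_density]_t (\1_A t * likelihood th t)%:E)%E.
Proof.
move=> mA; rewrite -[A in LHS]setIT -integral_indic//.
rewrite [LHS](ge0_integral_iter_product_density (measurable_ratio th)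
  (ratio_ge0 th) (integral_pert th)).
- by apply: eq_integral => t _; rewrite -EFinM.
- exact/measurable_EFinP.
- by move=> t; rewrite lee_fin.
Qed.

Lemma iid_law_setT n (f : density mu) : iid_law n f setT = 1%E.
Proof. by apply: iter_product_setT; exact: probability_setT. Qed.

Lemma likelihood_integral n th :
  (\int[iid_law n base_density]_t (likelihood th t)%:E = 1)%E.
Proof.
rewrite -(iid_law_setT n (pert th)) iid_law_likelihood//.
by apply: eq_integral => t _; rewrite indicT mul1r.
Qed.

(** The contribution of one cell to the correlation of two likelihood ratios.
    *)
Definition cell_weight c : R :=
  2 ^+ d * gam ^+ 2 *
  fine (\int[mu]_z (tensor (cell1 w c) (cell2 w c) z ^+ 2)%:E)%E.

Definition weight_bound : R := 2 ^+ d * gam ^+ 2 * (S ^+ 2 / M%:R) ^+ d.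

Let cell_fin c :
  (\int[mu]_z (tensor (cell1 w c) (cell2 w c) z ^+ 2)%:E \is a fin_num)%E.
Proof.
have /andP[_ h] := tensor_cell_sqr w M0 l0 c.
rewrite ge0_fin_numE ?(le_lt_trans h) ?ltry//.
by apply: integral_ge0 => z _; rewrite lee_fin sqr_ge0.
Qed.

Lemma cell_weight_bounds c : 0 <= cell_weight c <= weight_bound.
Proof.
have /andP[_ h] := tensor_cell_sqr w M0 l0 c.
have g0 : 0 <= 2 ^+ d * gam ^+ 2 by rewrite mulr_ge0 ?exprn_ge0 ?sqr_ge0.
apply/andP; split.
  rewrite mulr_ge0// fine_ge0// integral_ge0// => z _.
  by rewrite lee_fin sqr_ge0.
by rewrite /cell_weight ler_wpM2l// -lee_fin fineK.
Qed.

Lemma integral_noise th : mu.-integrable setT (EFin \o noise w gam th) /\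
  \int[mu]_z noise w gam th z = 0.
Proof.
have ip := density_integrable (pert th).
have ib := density_integrable base_density.
have e : EFin \o noise w gam th =
      ((EFin \o pert th) \- (EFin \o base_density))%E.
  by apply/funext => z /=; rewrite -EFinB /perturbed_fun /base addrAC subrr
    add0r.
split; first by rewrite e; exact: integrableB.
rewrite /Rintegral -/(EFin \o noise w gam th) e integralB//.
by rewrite !integral_density subee.
Qed.

Lemma integral_noise_mul th th' :
  mu.-integrable setT (fun z => (noise w gam th z * noise w gam th' z)%:E) /\
  (\int[mu]_z (2 ^+ d * (noise w gam th z * noise w gam th' z))) =
  \sum_(c : K) cell_weight c * sgn R th' c * sgn R th c.
Proof.
have ic c : mu.-integrable setT
    (fun z => (tensor (cell1 w c) (cell2 w c) z ^+ 2)%:E).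
  apply/integrableP; split.
    apply/measurable_EFinP; apply: measurable_funX.
    exact: measurable_tensor_cell.
  under eq_integral do rewrite /= ger0_norm ?sqr_ge0//.
  by rewrite -ge0_fin_numE// integral_ge0// => z _; rewrite lee_fin sqr_ge0.
pose s c : R := gam ^+ 2 * (sgn R th c * sgn R th' c).
have E z : (noise w gam th z * noise w gam th' z)%:E =
    (\sum_(c : K) (s c)%:E * (tensor (cell1 w c) (cell2 w c) z ^+ 2)%:E)%E.
  rewrite noise_mul big_distrr /= -sumEFin; apply: eq_bigr => c _.
  by rewrite -EFinM /s mulrA.
have isum : mu.-integrable setT
    (fun z => (noise w gam th z * noise w gam th' z)%:E).
  under eq_fun do rewrite E; apply: (integrable_sum measurableT) => c _.
  exact: integrableZl.
split => //; rewrite RintegralZl// /Rintegral.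
under eq_integral do rewrite E.
rewrite integral_sum//; last by move=> c; exact: integrableZl.
rewrite (_ : (\sum_c _)%E = (\sum_(c : K) (s c *
    fine (\int[mu]_z (tensor (cell1 w c) (cell2 w c) z ^+ 2)%:E)%E)%:E)%E).
  rewrite sumEFin big_distrr /=; apply: eq_bigr => c _.
  by rewrite /cell_weight /s; ring.
by apply: eq_bigr => c _; rewrite integralZl// [RHS]EFinM fineK.
Qed.

(** Expanding the product, the two linear terms have integral zero, and the
    disjointness of the cells leaves a diagonal sum. *)
Lemma ratio_mul_integral th th' :
  (\int[density_prob base_density]_z (ratio th z * ratio th' z)%:E =
   (1 + \sum_(c : K) cell_weight c * sgn R th' c * sgn R th c)%:E)%E.
Proof.
rewrite ge0_integral_density_prob; last 2 first.
- by apply/measurable_EFinP; apply: measurable_funM; exact: measurable_ratio.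
- by move=> z; rewrite lee_fin mulr_ge0// ratio_ge0.
have [i1 e1] := integral_noise th; have [i2 e2] := integral_noise th'.
have [i3 e3] := integral_noise_mul th th'.
have ib := density_integrable base_density.
have {}i3 : mu.-integrable setT (fun z =>
    (2 ^+ d * (noise w gam th z * noise w gam th' z))%:E).
  by under eq_fun do rewrite EFinM; exact: integrableZl.
have E z : ((ratio th z * ratio th' z)%:E * (base_density z)%:E =
    (base_density z)%:E + ((noise w gam th z)%:E + ((noise w gam th' z)%:E +
    (2 ^+ d * (noise w gam th z * noise w gam th' z))%:E)))%E.
  rewrite -EFinM -!EFinD; congr EFin.
  have -> : 2 ^+ d * (noise w gam th z * noise w gam th' z) =
      base z * relative_noise w gam th z * relative_noise w gam th' z.
    by rewrite -noise_relative /relative_noise mulrCA.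
  rewrite (noise_relative w gam th) (noise_relative w gam th') /ratio /base /=.
  by ring.
under eq_integral do rewrite E.
have i23 := integrableD measurableT i2 i3.
have i123 := integrableD measurableT i1 i23.
rewrite integralD// integral_density integralD//.
rewrite integralD//.
have f1 : (\int[mu]_z (noise w gam th z)%:E = 0)%E.
  by rewrite -[LHS]fineK; [congr EFin|exact: integrable_fin_num].
have f2 : (\int[mu]_z (noise w gam th' z)%:E = 0)%E.
  by rewrite -[LHS]fineK; [congr EFin|exact: integrable_fin_num].
by rewrite f1 f2 !add0e -e3 EFinD fineK//; exact: integrable_fin_num.
Qed.

Lemma likelihood_mul_integral n th th' :
  (\int[iid_law n base_density]_t (likelihood th t * likelihood th' t)%:E =
   ((1 + \sum_(c : K) cell_weight c * sgn R th' c * sgn R th c) ^+ n)%:E)%E.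
Proof.
under eq_integral do rewrite /likelihood -big_split /=.
rewrite [LHS](ge0_integral_iter_product_prod (density_prob base_density)
  (G := fun i z => ratio th z * ratio th' z)).
- under eq_bigr do rewrite ratio_mul_integral.
  by rewrite prodEFin prodr_const card_ord.
- by move=> i; apply: measurable_funM; exact: measurable_ratio.
- by move=> i z; rewrite mulr_ge0// ratio_ge0.
Qed.

(** For a fixed [th'], the signs of [th'] go into the coefficients: the signs
    of [th] alone are averaged, which gives a bound that does not depend on
    [th']. *)
Lemma sum_likelihood_mul n : n%:R * weight_bound <= 2^-1 ->
  (\sum_th \sum_th' \int[iid_law n base_density]_t
     (likelihood th t * likelihood th' t)%:E <=
   (#|{ffun K -> bool}|%:R ^+ 2 *
    expR (2 * (M%:R ^+ d * (n%:R * weight_bound) ^+ 2)))%:E)%E.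
Proof.
move=> nb; set N : R := #|_|%:R; set B := expR _.
rewrite exchange_big /=.
apply: (@le_trans _ _ (\sum_(th' : {ffun K -> bool}) (N * B)%:E)%E); last first.
  by rewrite sumEFin sumr_const -[_ *+ #|_|]mulr_natl mulrA expr2.
apply: lee_sum => th' _; under eq_bigr do rewrite likelihood_mul_integral.
rewrite sumEFin lee_fin.
pose a c := n%:R * cell_weight c * sgn R th' c.
have na c : `|a c| <= n%:R * weight_bound.
  have /andP[c0 cb] := cell_weight_bounds c.
  have nc0 : 0 <= n%:R * cell_weight c by apply: mulr_ge0.
  by rewrite /a normrM normr_sgn mulr1 (ger0_norm nc0); apply: ler_wpM2l.
apply: (@le_trans _ _ (\sum_th expR (\sum_c a c * sgn R th c))).
  apply: ler_sum => th _.
  have -> : \sum_c a c * sgn R th c =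
      n%:R * \sum_c cell_weight c * sgn R th' c * sgn R th c.
    by rewrite big_distrr /=; apply: eq_bigr => c _; rewrite /a !mulrA.
  rewrite expRM_natl; apply: lerXn2r; rewrite ?nnegrE ?expR_ge0//.
    rewrite -lee_fin -ratio_mul_integral; apply: integral_ge0 => z _.
    by rewrite lee_fin mulr_ge0// ratio_ge0.
  exact: expR_ge1Dx.
apply: le_trans (sum_exp_sgn _) _ => [c|]; first exact: le_trans (na c) nb.
rewrite -/N ler_wpM2l// /B ler_expR ler_wpM2l//.
apply: (@le_trans _ _ (\sum_(c : K) (n%:R * weight_bound) ^+ 2)).
  apply: ler_sum => c _; rewrite -[leLHS]real_normK ?num_real// lerXn2r
    ?nnegrE//.
  exact: le_trans (na c).
by rewrite sumr_const -[_ *+ #|_|]mulr_natl card_cells.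
Qed.

End likelihood.

(** * The lower bound *)

Section lower_bound.
Variables (R : realType) (M : nat) (S l D : R) (k : nat).
Variable w : bump_system M S l D k.
Variables (p q : nat) (gam : R).
Hypotheses (M0 : (0 < M)%N) (p0 : (0 < p)%N) (q0 : (0 < q)%N).
Hypotheses (l0 : 0 < l) (gam0 : 0 <= gam).
Hypothesis gam_small : gam * (2 * S) ^+ (p + q) <= 1.
Local Notation RR := (measurableTypeR R).
Local Notation d := (p + q)%N.
Local Notation K := {ffun 'I_(p + q) -> 'I_M}.
Local Notation E := ((p.-tuple RR) * (q.-tuple RR))%type.
Local Notation mu := (lebesgue2 R p q).
Implicit Types (th : {ffun K -> bool}).
Local Notation pert := (pert w q0 gam0 gam_small).

Lemma pert_alternative (delta r r' rho : R) th :
  (energy w gam delta th <= ((2 * pi) ^+ d * r ^+ 2)%:E)%E ->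
  1 <= r' -> 0 <= rho -> rho ^+ 2 < gam ^+ 2 * l ^+ d ->
  alternatives delta r r' rho (pert th).
Proof.
move=> en r'1 rho0 rho_lt; rewrite /alternatives /= /pert.
rewrite dependence_perturbed// marginal1_perturbed marginal2_perturbed//.
have half1 e : (2^-1 : R) ^+ e <= 1.
  by rewrite exprn_ile1 ?invr_ge0 ?invf_le1 ?ler1n.
have r'0 : 0 <= r' by apply: le_trans r'1.
split.
- by split; [exact: noise_Lfun1|exact: noise_Lfun2|exact: en].
- rewrite !ge_max; apply/and3P; split; apply: Lnorm_oo_le => // x.
  + apply: le_trans r'1; rewrite ger0_norm ?perturbed_ge0//.
    have h := noise_le w gam0 gam_small th x.
    have b := base_le x.
    have : (2^-1 : R) ^+ (p + q) <= 2^-1.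
      by rewrite -(prednK (ltn_addr q p0)) exprS ler_piMr// invr_ge0.
    by move: h; rewrite ler_norml /= /perturbed_fun => /andP[h1 h2]; lra.
  + rewrite ger0_norm ?cube_ge0//; apply: le_trans r'1.
    exact: le_trans (cube_le x) (half1 p).
  + rewrite ger0_norm ?cube_ge0//; apply: le_trans r'1.
    exact: le_trans (cube_le x) (half1 q).
- apply: lt_Lnorm2 => //; apply: lt_le_trans (noise_sqr_ge w gam M0 l0 th).
  by rewrite lte_fin.
Qed.

Lemma test_power (n : nat) (alpha e : R) (Delta : sample R p q n -> bool) :
  level_test alpha Delta -> 0 < e ->
  n%:R * weight_bound M S p q gam <= 2^-1 ->
  (\sum_th iid_law n (pert th) [set z | Delta z = true] <=
   (#|{ffun K -> bool}|%:R * (alpha +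
     (expR (2 * (M%:R ^+ d * (n%:R * weight_bound M S p q gam) ^+ 2)) - 1) / (2
       * e)
     + e / 2))%:E)%E.
Proof.
move=> [mD levelD] e0 nb.
have mA : measurable [set z | Delta z = true].
  by rewrite -[X in measurable X]setTI; exact: (mD measurableT [set true]).
under eq_bigr do rewrite iid_law_likelihood//.
apply: (@second_moment_bound _ _ _ (iid_law n (base_density R p q))) => //.
- exact: iid_law_setT.
- exact: [ffun=> true].
- by move=> th; exact: measurable_likelihood.
- by move=> th t; exact: likelihood_ge0.
- by move=> th; exact: likelihood_integral.
- exact: levelD.
- by rewrite addrCA subrr addr0; exact: sum_likelihood_mul.
Qed.

(** The sign patterns of too large a Sobolev energy form, by Markov's
    inequality, a proportion at most [eta]. If all the other patterns were
    separated by more than [rho], the test would have an average power of at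
    least [1 - beta - eta], which exceeds [alpha] by more than the second
    moment of the likelihood ratio allows. *)
Lemma separation_lower_bound (n : nat) (alpha beta eta delta r r' rho : R)
    (Delta : sample R p q n -> bool) :
  alpha + beta + eta < 1 -> 0 < r -> 1 <= r' -> 0 < delta -> 0 < rho ->
  0 <= beta ->
  1 + delta <= (2 * k)%:R ->
  (gam * M%:R `^ delta) ^+ 2 * (D ^+ 2) ^+ d <= eta * r ^+ 2 ->
  n%:R * weight_bound M S p q gam <= 2^-1 ->
  expR (2 * (M%:R ^+ d * (n%:R * weight_bound M S p q gam) ^+ 2)) - 1 <
    (1 - (alpha + beta + eta)) ^+ 2 ->
  level_test alpha Delta ->
  (ereal_sup [set iid_law n f [set z | Delta z = false]
             | f in alternatives delta r r' rho] <= beta%:E)%E ->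
  gam ^+ 2 * l ^+ d <= rho ^+ 2.
Proof.
move=> abe1 r0 r'1 delta0 rho0 beta0 kl smooth nb chi2 levelD sup_le.
rewrite leNgt; apply/negP => rho_lt.
set e := 1 - (alpha + beta + eta) in chi2.
have e0 : 0 < e by rewrite subr_gt0.
set N : R := #|{ffun K -> bool}|%:R.
have N0 : 0 < N by rewrite ltr0n; apply/card_gt0P; exists [ffun=> true].
pose thr := (2 * pi) ^+ d * r ^+ 2.
have thr0 : 0 < thr by rewrite mulr_gt0 ?exprn_gt0// mulr_gt0// pi_gt0.
pose bad th : bool := (thr%:E < energy w gam delta th)%E.
have energy_ge0 th : (0 <= energy w gam delta th)%E.
  by apply: integral_ge0 => u _; rewrite lee_fin mulr_ge0 ?powR_ge0 ?sqr_ge0.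
have bad_le : \sum_th (bad th)%:R <= N * eta.
  have : (\sum_(th : {ffun K -> bool}) (thr * (bad th)%:R)%:E <=
      \sum_(th : {ffun K -> bool}) energy w gam delta th)%E.
    apply: lee_sum => th _; have [hb|_] := boolP (bad th).
      by rewrite mulr1; exact: ltW.
    by rewrite mulr0.
  move=> /le_trans /(_ (sum_energy w p q gam M0 delta0 kl)).
  rewrite sumEFin lee_fin -big_distrr /= => h.
  rewrite -(ler_pM2l thr0); apply: le_trans h _.
  rewrite -/N [leRHS]mulrCA ler_pM2l//.
  have -> : (2 * pi * D ^+ 2) ^+ d = (2 * pi) ^+ d * (D ^+ 2) ^+ d.
    by rewrite exprMn.
  rewrite [leLHS]mulrCA /thr -[leRHS]mulrA [r ^+ 2 * _]mulrC ler_wpM2l//.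
  by rewrite exprn_ge0// mulr_ge0// pi_ge0.
have mA : measurable [set z | Delta z = true].
  have [mD _] := levelD.
  by rewrite -[X in measurable X]setTI; exact: (mD measurableT [set true]).
have power th : ((1 - beta - (bad th)%:R)%:E <=
    iid_law n (pert th) [set z | Delta z = true])%E.
  have [badth|goodth] := boolP (bad th).
    by apply: le_trans (measure_ge0 _ _); rewrite lee_fin /=; lra.
  have alt : alternatives delta r r' rho (pert th).
    apply: pert_alternative => //; last exact: ltW.
    by rewrite -leNgt in goodth.
  have miss : (iid_law n (pert th) [set z | Delta z = false] <= beta%:E)%E.
    apply: le_trans sup_le; apply: ereal_sup_ubound.
    by exists (pert th).
  have total : (iid_law n (pert th) [set z | Delta z = true] +
      iid_law n (pert th) [set z | Delta z = false] = 1)%E.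
    rewrite -(iid_law_setT n (pert th)) -measureU//.
    - congr (_ _); apply/seteqP; split => // z _ /=.
      by case: (Delta z); [left|right].
    - rewrite (_ : [set z | _] = ~` [set z | Delta z = true]).
        exact: measurableC.
      by apply/seteqP; split => z /=; case: (Delta z).
    - by apply/seteqP; split => z //= [-> ].
  have fmiss : iid_law n (pert th) [set z | Delta z = false] \is a fin_num.
    by rewrite ge0_fin_numE ?(le_lt_trans miss) ?ltry.
  rewrite subr0 EFinB leeBlDr// -[1%:E]total.
  by apply: leeD.
have := test_power levelD e0 nb; rewrite -/N.
have : ((N * (1 - beta - eta))%:E <=
    \sum_th iid_law n (pert th) [set z | Delta z = true])%E.
  apply: (@le_trans _ _ (\sum_th (1 - beta - (bad th)%:R)%:E)%E); last first.
    by apply: lee_sum => th _; exact: power.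
  rewrite sumEFin lee_fin big_split /= sumrN sumr_const -[_ *+ #|_|]mulr_natl.
  by rewrite -/N mulrBr lerB// .
move=> /le_trans /[apply]; rewrite lee_fin ler_pM2l// => h.
have : e <= (expR (2 * (M%:R ^+ d * (n%:R * weight_bound M S p q gam) ^+ 2)) -
  1) / (2 * e)
     + e / 2 by move: h; rewrite /e; lra.
rewrite -lerBlDr ler_pdivlMr ?mulr_gt0// => h2.
have : (e - e / 2) * (2 * e) < e ^+ 2 by apply: le_lt_trans h2 chi2.
by rewrite (_ : _ * _ = e ^+ 2) ?ltxx//; field.
Qed.

End lower_bound.

Lemma exists_resolution (R : realType) (nu : R) (n : nat) : (0 < n)%N -> 0 < nu
  ->
  exists2 M : nat, (0 < M)%N & n%:R `^ nu <= M%:R <= 2 * n%:R `^ nu.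
Proof.
move=> n0 nu0; have x1 : 1 <= n%:R `^ nu :> R.
  rewrite -[leLHS](powRr0 (n%:R : R)); apply: ler_powR; first by rewrite ler1n.
  exact: ltW.
exists (Num.truncn (n%:R `^ nu : R)).+1 => //.
have /andP[t1 t2] := truncn_itv (le_trans ler01 x1).
by rewrite (ltW t2) /= -natr1; lra.
Qed.

Theorem theorem4 (R : realType) (p q : nat) (alpha beta eta delta r r' : R)
  (p_ge1 : (1 <= p)%N) (q_ge1 : (1 <= q)%N)
  (alpha01 : 0 < alpha < 1) (beta01 : 0 < beta < 1) (eta01 : 0 < eta < 1)
  (sum_lt1 : alpha + beta + eta < 1)
  (delta_gt0 : 0 < delta) (r_gt0 : 0 < r) (r'_ge1 : 1 <= r') :
  exists2 C : R, 0 < C &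
    \forall n \near \oo,
      ((C * n%:R `^ (- (2 * delta / (4 * delta + (p + q)%:R))))%:E
        <= minimax_rate p q n delta r r' alpha beta)%E.
Proof.
have d0 : (0 < p + q)%N by rewrite ltn_addr.
set k := (Num.truncn (1 + delta)).+1.
have kl : 1 + delta <= (2 * k)%:R.
  have /andP[_ /ltW h] := truncn_itv (addr_ge0 ler01 (ltW delta_gt0)).
  by apply: le_trans h _; rewrite ler_nat mul2n -addnn leq_addr.
have [S [l [D [[S0 l0 D0] sys]]]] := exists_bump_system R k.
set d := (p + q)%N in d0 *.
move: alpha01 beta01 eta01 => /andP[a0 a1] /andP[b0 b1] /andP[h0 h1].
pose e := 1 - (alpha + beta + eta); have e0 : 0 < e by rewrite /e subr_gt0.
have e1 : e < 1 by rewrite /e; lra.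
pose B := (2 * S ^+ 2) ^+ d; have B0 : 0 < B by rewrite exprn_gt0// mulr_gt0//
  exprn_gt0.
have S2 : 0 < (2 * S) ^+ d by rewrite exprn_gt0// mulr_gt0.
have D2 : 0 < (D ^+ 2) ^+ d by rewrite !exprn_gt0.
(* The amplitude of the noise is c / M^delta. The four bounds on c give, in
   this order, c^2 <= c, the positivity of the perturbed densities, the Sobolev
   bound, and the smallness of the second moment. *)
pose c := Num.min 1 (Num.min ((2 * S) ^+ d)^-1
  (Num.min (eta * r ^+ 2 / (D ^+ 2) ^+ d) (e / 3 / B))).
have c0 : 0 < c.
  by rewrite !lt_min ltr01 invr_gt0 S2 !divr_gt0// mulr_gt0// exprn_gt0.
have : c <= c by []. rewrite {2}/c !le_min => /and4P[c1 cS cD cB].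
have c2 : c ^+ 2 <= c by rewrite expr2 ler_piMl// ltW.
have delta0 := ltW delta_gt0.
pose s := 4 * delta + d%:R; have s0 : 0 < s.
  by rewrite addr_gt0 ?mulr_gt0 ?ltr0n.
exists (c * Num.sqrt (l ^+ d) * 2 `^ (- delta)).
  by rewrite !mulr_gt0 ?sqrtr_gt0 ?exprn_gt0 ?powR_gt0.
exists 1%N => // n /= n1.
have [M M0 /andP[M1 M2]] := exists_resolution n1 (divr_gt0 (ltr0Sn R 1) s0).
have [w] := sys M M0.
have m0 : (0 : R) < M%:R by rewrite ltr0n.
have n0 : (0 : R) < n%:R by rewrite ltr0n.
pose x : R := M%:R `^ delta; have x0 : 0 < x by rewrite powR_gt0.
pose gam := c / x; have gam0 : 0 <= gam by rewrite divr_ge0 ?ltW.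
have x1 : 1 <= x by rewrite /x -[leLHS](powRr0 (M%:R : R)) ler_powR ?ler1n.
have gam_small : gam * (2 * S) ^+ d <= 1.
  by rewrite -ler_pdivlMr// div1r (le_trans _ cS)// ler_pdivrMr// ler_peMr//
    ltW.
have smooth : (gam * M%:R `^ delta) ^+ 2 * (D ^+ 2) ^+ d <= eta * r ^+ 2.
  by rewrite /gam mulfVK ?gt_eqF// -ler_pdivlMr// (le_trans c2).
(* The resolution balances the two requirements: n^2 <= M^(4 delta + d). *)
have nM : n%:R ^+ 2 <= x ^+ 4 * M%:R ^+ d.
  have : (n%:R `^ (2 / s)) `^ s <= M%:R `^ s :> R.
    by apply: ge0_ler_powR; rewrite ?nnegrE ?powR_ge0// ltW.
  rewrite -powRrM mulfVK ?gt_eqF// powR_mulrn// /s powRD; last first.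
    by rewrite (gt_eqF m0) implybT.
  by rewrite [M%:R `^ d%:R]powR_mulrn// [4 * _]mulrC powRrM powR_mulrn// ltW.
have wB : n%:R * weight_bound M S p q gam = B * c ^+ 2 * (n%:R / (x ^+ 2 * M%:R
  ^+ d)).
  have alg (f g m y b t : R) : m != 0 -> y != 0 ->
      t * (f * (b ^+ 2 / y ^+ 2) * (g / m)) = f * g * b ^+ 2 * (t / (y ^+ 2 *
        m)).
    by move=> m1 y1; field; rewrite m1 y1.
  rewrite /weight_bound /B /gam -/d !expr_div_n [(2 * S ^+ 2) ^+ d]exprMn.
  by rewrite alg// ?expf_neq0 ?gt_eqF.
have y_le : M%:R ^+ d * (n%:R * weight_bound M S p q gam) ^+ 2 <= (B * c ^+ 2)
  ^+ 2.
  have xM : 0 < x ^+ 4 * M%:R ^+ d by rewrite mulr_gt0 ?exprn_gt0.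
  have -> : M%:R ^+ d * (n%:R * weight_bound M S p q gam) ^+ 2 =
      (B * c ^+ 2) ^+ 2 * (n%:R ^+ 2 / (x ^+ 4 * M%:R ^+ d)).
    have alg (m y b t : R) : m != 0 -> y != 0 ->
        m * (b * (t / (y ^+ 2 * m))) ^+ 2 = b ^+ 2 * (t ^+ 2 / (y ^+ 4 * m)).
      by move=> m1 y1; field; rewrite m1 y1.
    by rewrite wB alg// ?expf_neq0 ?gt_eqF.
  by rewrite ler_piMr ?sqr_ge0// ler_pdivrMr// mul1r.
have Bc : B * c ^+ 2 <= e / 3.
  by rewrite mulrC -ler_pdivlMr// (le_trans c2).
have nb : n%:R * weight_bound M S p q gam <= 2^-1.
  apply: (@le_trans _ _ (B * c ^+ 2)); last by lra.
  rewrite -(@ler_pXn2r _ 2) ?nnegrE//; last 2 first.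
  - rewrite wB; apply: mulr_ge0; first by rewrite mulr_ge0 ?sqr_ge0 ?(ltW B0).
    by rewrite divr_ge0 ?ler0n// mulr_ge0 ?sqr_ge0// exprn_ge0 ?ler0n.
  - by rewrite mulr_ge0 ?sqr_ge0 ?(ltW B0).
  apply: le_trans y_le; rewrite ler_peMl ?sqr_ge0//.
  by rewrite exprn_ege1// ler1n.
have chi2 : expR (2 * (M%:R ^+ d * (n%:R * weight_bound M S p q gam) ^+ 2)) - 1
  < e ^+ 2.
  set u := 2 * _; have u0 : 0 <= u.
    by rewrite /u mulr_ge0// mulr_ge0 ?sqr_ge0// exprn_ge0// ltW.
  have ue : u <= 2 * (e / 3) ^+ 2.
    rewrite /u ler_pM2l//; apply: le_trans y_le _.
    rewrite lerXn2r// nnegrE; last by rewrite divr_ge0// ltW.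
    by rewrite mulr_ge0 ?sqr_ge0 ?(ltW B0).
  have uE : (1 - u) * expR u <= 1.
    rewrite -[leRHS](expRxMexpNx_1 u) mulrC ler_wpM2l ?expR_ge0//.
    exact: expR_ge1Dx.
  have e2 : e ^+ 2 < 1 by rewrite expr_lt1// ltW.
  have e20 : 0 < e ^+ 2 by rewrite exprn_gt0.
  have uu : u <= 2 / 9 * e ^+ 2 by apply: le_trans ue _; rewrite expr_div_n;
    lra.
  have u1 : 0 < 1 - u by lra.
  have key : 1 < (1 - u) * (1 + e ^+ 2) by nra.
  have := le_lt_trans uE key; rewrite ltr_pM2l//; lra.
apply: le_ereal_inf_tmp => _ [Delta levelD <-].
apply: le_ereal_inf_tmp => _ [rho [rho0 sup_le] <-].
have := separation_lower_bound w M0 p_ge1 q_ge1 l0 gam0 gam_small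
  (n := n) (alpha := alpha) (beta := beta) (eta := eta) (delta := delta)
  (r := r) (r' := r') (rho := rho) (Delta := Delta).
move=> /(_ sum_lt1 r_gt0 r'_ge1 delta_gt0 rho0 (ltW b0) kl smooth nb chi2
  levelD sup_le) h.
rewrite lee_fin; apply: (@le_trans _ _ (gam * Num.sqrt (l ^+ d))); last first.
  rewrite -(@ler_pXn2r _ 2) ?nnegrE ?(mulr_ge0 gam0 (sqrtr_ge0 _)) ?(ltW
    rho0)//.
  by rewrite exprMn sqr_sqrtr// exprn_ge0// ltW.
have x_le : x <= 2 `^ delta * n%:R `^ (2 * delta / s).
  rewrite [2 * delta / s]mulrAC powRrM -powRM ?powR_ge0//.
  by apply: ge0_ler_powR; rewrite ?nnegrE ?mulr_ge0 ?powR_ge0// ltW.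
rewrite -/s !powRN /gam.
rewrite (_ : _ / _ = c * Num.sqrt (l ^+ d) *
    (2 `^ delta * n%:R `^ (2 * delta / s))^-1); last by rewrite invfM mulrA.
rewrite [c / x * _]mulrAC ler_wpM2l//.
  by rewrite mulr_ge0 ?sqrtr_ge0// ltW.
by rewrite lef_pV2// posrE mulr_gt0// powR_gt0.
Qed.
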